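(* Let $\lambda>0$ and let $K_\lambda$, $M(\lambda)$, $\omega_\lambda$ be as in the context. Let $\gamma>0$, $\Delta>0$, $\sigma>0$. Let $\Lambda=\{\Omega_1,\dots,\Omega_N\}$ be a finite $\Delta$-partition of $\Omega$. Let $\Lambda_*=\{0=z_0<z_1<\dots<z_a=\gamma\}$ be a uniform partition of $[0,\gamma]$ with step $\delta=\gamma/a$. Let $E_\sigma=\{e_1,\dots,e_c\}$ be a finite $\sigma$-net on the unit sphere $E=\{x\in\mathbb{R}^n:\|x\|=1\}$. Define $$B_p^{\gamma,\Delta,\delta,\sigma}(r)=\Big\{x:\Omega\to\mathbb{R}^n:\ x(\xi)=z_{j_i}e_{l_i}\text{ for all }\xi\in\Omega_i,\ \text{where } z_{j_i}\in\Lambda_*,\ e_{l_i}\in E_\sigma\ (i=1,\dots,N),\ \sum_{i=1}^N\mu(\Omega_i)z_{j_i}^p\le r^p\Big\}$$ and $\mathcal{F}_p^{\gamma,\Delta,\delta,\sigma}(r)=\{F(x):x\in B_p^{\gamma,\Delta,\delta,\sigma}(r)\}$, which is a finite set. Then $$h_q\big(\mathcal{F}_p(r),\mathcal{F}_p^{\gamma,\Delta,\delta,\sigma}(r)\big)\le \lambda+\frac{c_*M(\lambda)}{\gamma^{p-1}}+\psi_\lambda(\Delta)+\varphi_\lambda(\delta)+\alpha_\lambda(\gamma,\sigma),$$ where $c_*=2r^p[\mu(\Omega)]^{1/q}$, $\psi_\lambda(\Delta)=2r[\mu(\Omega)]^{2/q}\omega_\lambda(\Delta)$, $\varphi_\lambda(\delta)=M(\lambda)[\mu(\Omega)]^{1+1/q}\delta$,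 and $\alpha_\lambda(\gamma,\sigma)=M(\lambda)[\mu(\Omega)]^{1+1/q}\gamma\sigma$.
   Context: Let $k,m,n\ge 1$ be integers and let $\Omega\subset\mathbb{R}^k$ be a compact set. Let $\mu$ denote Lebesgue measure. Let $p>1$, let $q$ satisfy $1/p+1/q=1$, and let $r>0$. Throughout, $\|\cdot\|$ denotes the Euclidean norm on vectors and the Euclidean (Frobenius) norm on $m\times n$ matrices. $L_p(\Omega;\mathbb{R}^n)$ is the space of Lebesgue measurable $x:\Omega\to\mathbb{R}^n$ with $\|x\|_p=(\int_\Omega\|x(s)\|^p\,ds)^{1/p}<\infty$. Set $B_p(r)=\{x\in L_p(\Omega;\mathbb{R}^n):\|x\|_p\le r\}$. For $U,V\subset L_q(\Omega;\mathbb{R}^m)$, $h_q(U,V)$ denotes the Hausdorff distance $\max\{\sup_{u\in U}\inf_{v\in V}\|u-v\|_q,\ \sup_{v\in V}\inf_{u\in U}\|u-v\|_q\}$. $K:\Omega\times\Omega\to\mathbb{R}^{m\times n}$ is Lebesgue measurable with $\int_\Omega\int_\Omega\|K(\xi,s)\|^q\,d\xi\,ds<\infty$. The Hilbert–Schmidt operator is $F(x)(\xi)=\int_\Omega K(\xi,s)x(s)\,ds$ for a.e. $\xi\in\Omega$, and $\mathcal{F}_p(r)=\{F(x):x\in B_p(r)\}\subset L_q(\Omega;\mathbb{R}^m)$. For $\lambda>0$, $K_\lambda:\Omega\times\Omega\to\mathbb{R}^{m\times n}$ is a continuous function with $\big(\int_\Omega\int_\Omega\|K(\xi,s)-K_\lambda(\xi,s)\|^q\,d\xi\,ds\big)^{1/q}\le\lambda/(2r)$.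 Set $M(\lambda)=\max\{\|K_\lambda(\xi,s)\|:(\xi,s)\in\Omega\times\Omega\}$. For $\Delta>0$, set $\omega_\lambda(\Delta)=\max\{\|K_\lambda(\xi,s_2)-K_\lambda(\xi,s_1)\|:\xi,s_1,s_2\in\Omega,\ \|s_2-s_1\|\le\Delta\}$. A finite $\Delta$-partition of $\Omega$ is a finite family $\{\Omega_1,\dots,\Omega_N\}$ of pairwise disjoint Lebesgue measurable subsets of $\Omega$ whose union is $\Omega$, with $\operatorname{diam}(\Omega_i)=\sup\{\|x-y\|:x,y\in\Omega_i\}\le\Delta$ for each $i$. A finite $\sigma$-net on $E$ is a finite set $E_\sigma\subset E$ such that every point of $E$ is within distance $\sigma$ of some point of $E_\sigma$. *)

(* Defs.v *)
From HB Require Import structures.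
From mathcomp Require Import all_boot all_order all_algebra.
From mathcomp Require Import all_classical all_reals all_analysis.
Import numFieldNormedType.Exports.

Set Implicit Arguments.
Unset Strict Implicit.
Unset Printing Implicit Defensive.
Import Order.TTheory GRing.Theory Num.Theory.
Local Open Scope classical_set_scope.
Local Open Scope ring_scope.

Definition enorm (R : realType) (m n : nat) (A : 'M[R]_(m, n)) : R :=
  Num.sqrt (\sum_(i < m) \sum_(j < n) A i j ^+ 2).

(** ** Lebesgue measure on R^k (points of R^k are row vectors 'rV[R]_k).
    Construction: Lebesgue outer measure = inf over countable covers by
    half-open boxes of the sum of their volumes; Lebesgue measurable sets
    = Caratheodory measurable sets; Lebesgue measure = restriction. *)

Section Lebesgue_Rk.
Variables (R : realType) (k : nat).

(* auxiliary copy of R^k on which every set is declared "measurable"; it is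
   only used to feed the generic outer-measure construction [mu_ext], where
   non-box sets get infinite weight, so that only box covers matter. *)
Definition Rk_all : Type := 'rV[R]_k.
HB.instance Definition _ := Pointed.on Rk_all.

Let all_sets : set (set Rk_all) := setT.
Let all_sets0 : all_sets set0. Proof. by []. Qed.
Let all_setsC A : all_sets A -> all_sets (~` A). Proof. by []. Qed.
Let all_sets_bigcup (F : (set Rk_all)^nat) :
  (forall i, all_sets (F i)) -> all_sets (\bigcup_i F i).
Proof. by []. Qed.
HB.instance Definition _ := @isMeasurable.Build default_measure_display Rk_all
  all_sets all_sets0 all_setsC all_sets_bigcup.

Definition hobox (a b : 'rV[R]_k) : set 'rV[R]_k :=
  [set x | forall i, a 0 i <= x 0 i < b 0 i].

Definition box_volume (ab : 'rV[R]_k * 'rV[R]_k) : R :=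
  \prod_(i < k) (ab.2 0 i - ab.1 0 i).

(* weight of a set: its volume if it is a (non-degenerate-or-empty) box,
   +oo otherwise *)
Definition box_weight (A : set Rk_all) : \bar R :=
  if pselect (A = set0) then 0%E else
  ereal_inf [set (box_volume ab)%:E | ab in
    [set ab : 'rV[R]_k * 'rV[R]_k |
      (forall i, ab.1 0 i <= ab.2 0 i) /\ A = hobox ab.1 ab.2]].

Lemma box_weight0 : box_weight set0 = 0%E.
Proof. by rewrite /box_weight; destruct (pselect (@set0 (Rk_all) = set0)). Qed.

Lemma box_weight_ge0 A : (0 <= box_weight A)%E.
Proof.
rewrite /box_weight; destruct (pselect (A = set0)) as [h|h]; first by [].
apply: le_ereal_inf_tmp => y [ab [hab _] <-].
rewrite lee_fin /box_volume; apply: prodr_ge0 => i _.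
by rewrite subr_ge0.
Qed.

Definition lebesgue_outer : set Rk_all -> \bar R :=
  mu_ext box_weight.

HB.instance Definition _ := isOuterMeasure.Build R Rk_all lebesgue_outer
  (mu_ext0 box_weight0 box_weight_ge0) (mu_ext_ge0 box_weight_ge0)
  (le_mu_ext box_weight) (mu_ext_sigma_subadditive box_weight_ge0).

End Lebesgue_Rk.

Definition lebesgue_om (R : realType) (k : nat) :
  {outer_measure set Rk_all R k -> \bar R} := @lebesgue_outer R k.
Definition Rk (R : realType) (k : nat) := caratheodory_type (lebesgue_om R k).

Notation lebesgue R k := (lebesgue_om R k : set (Rk R k) -> \bar R).


Local Open Scope ereal_scope.

Section Operators.
Variables (R : realType) (k m n : nat).
Local Notation mu := (lebesgue R k).

Definition lmeasurable_vec (l : nat) (Om : set (Rk R k)) (x : Rk R k -> 'cV[R]_l) :=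
  forall j : 'I_l, measurable_fun Om (fun s => x s j ord0).

Definition Lpnorm (l : nat) (p : R) (Om : set (Rk R k)) (x : Rk R k -> 'cV[R]_l)
  : \bar R :=
  (\int[mu]_(s in Om) (powR (enorm (x s)) p)%:E) `^ p^-1.

Definition Lp (l : nat) (p : R) (Om : set (Rk R k)) : set (Rk R k -> 'cV[R]_l) :=
  [set x | lmeasurable_vec Om x /\ Lpnorm p Om x < +oo].

Definition Bp (p : R) (Om : set (Rk R k)) (r : R) : set (Rk R k -> 'cV[R]_n) :=
  [set x | Lp p Om x /\ Lpnorm p Om x <= r%:E].

Definition HS (Om : set (Rk R k)) (K : Rk R k -> Rk R k -> 'M[R]_(m, n))
  (x : Rk R k -> 'cV[R]_n) : Rk R k -> 'cV[R]_m :=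
  fun xi => \col_(i < m) (\int[mu]_(s in Om) ((K xi s *m x s) i ord0))%R.

Definition Ldist (q : R) (Om : set (Rk R k)) (u v : Rk R k -> 'cV[R]_m) : \bar R :=
  Lpnorm q Om (fun xi => u xi - v xi)%R.

Definition hausdorff_q (q : R) (Om : set (Rk R k))
  (U V : set (Rk R k -> 'cV[R]_m)) : \bar R :=
  maxe (ereal_sup [set ereal_inf [set Ldist q Om u v | v in V] | u in U])
       (ereal_sup [set ereal_inf [set Ldist q Om u v | u in U] | v in V]).

Definition lmeasurable_kernel (Om : set (Rk R k))
  (K : Rk R k -> Rk R k -> 'M[R]_(m, n)) :=
  forall (i : 'I_m) (j : 'I_n),
    measurable_fun
      [set z : Rk R (k + k) | Om (lsubmx (z : 'rV[R]_(k + k))) /\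
                              Om (rsubmx (z : 'rV[R]_(k + k)))]
      (fun z : Rk R (k + k) =>
         K (lsubmx (z : 'rV[R]_(k + k))) (rsubmx (z : 'rV[R]_(k + k))) i j).

Definition diam (A : set 'rV[R]_k) : \bar R :=
  ereal_sup [set (enorm (x - y))%:E | x in A & y in A].

Definition Mmax (Om : set (Rk R k)) (Kl : Rk R k -> Rk R k -> 'M[R]_(m, n)) : R :=
  sup [set enorm (Kl xi s) | xi in Om & s in Om].

Definition modulus (Om : set (Rk R k)) (Kl : Rk R k -> Rk R k -> 'M[R]_(m, n))
  (Delta : R) : R :=
  sup [set enorm (Kl t.1 t.2.2 - Kl t.1 t.2.1)%R |
        t in [set t : 'rV[R]_k * ('rV[R]_k * 'rV[R]_k) |
               Om t.1 /\ Om t.2.1 /\ Om t.2.2 /\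
               (enorm (t.2.2 - t.2.1) <= Delta)%R]].

End Operators.

(* Main.v *)
(** Proof idea. Given x in the ball, truncate it at height gam, average the
    truncation over each cell of the partition, and round each average a_i to
    z_j e_l with z_j <= |a_i|: Jensen's inequality keeps the rounded step function
    y in the discrete ball. At a point xi, the vector u = F(x)(xi) - F(y)(xi) is
    estimated by testing it against itself, u . u = int u . (K - K_lam)(x - y) +
    int (K_lam^T u) . (x - y); the first term is bounded by Hoelder's inequality,
    the second one cell by cell, the averages cancelling the cellwise constant part
    of K_lam. Minkowski's inequality in L_q concludes.

    The hypothesis integrates |K - K_lam|^q in the order opposite to the one needed.
    To swap the integrals, the Lebesgue measurable kernel on R^(2k) is replaced by a
    function measurable for the product sigma-algebra, off a null set of the product
    measure: covers by boxes, whose product measure is at most their volume, compare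
    both measures. Since the integral of an arbitrary nonnegative function is a lower
    integral, monotonicity up to null sets holds without measurability. *)
Require Import Defs.
From HB Require Import structures.
From mathcomp Require Import all_boot all_order all_algebra.
From mathcomp Require Import all_classical all_reals all_analysis.
From mathcomp Require Import measurable_realfun ring lra.
Import numFieldNormedType.Exports.
Import Order.TTheory GRing.Theory Num.Theory.
Local Open Scope classical_set_scope.
Local Open Scope ring_scope.

Set Implicit Arguments.
Unset Strict Implicit.
Unset Printing Implicit Defensive.

(** * Euclidean norm *)

(** The error terms originate as follows. Minkowski gives [|x - y|_p <= 2 r], which the factor
    [lam / (2 * r)] turns into [lam]. Where [|x s| > gam], one has [|x s| <= |x s|^p / gam^(p-1)],
    whence the term in [M]. Over a cell the oscillation of [Kl] is paired with the truncation minus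
    its average, whose integral is at most twice that of [|x|]; Hoelder bounds the latter by
    [r mu^(1/q)], and a second [mu^(1/q)] is the [L_q] norm of a constant in [xi]. The rounding
    error is at most [delta + gam * sigma]: norm, then direction. Truncation comes before averaging
    because the grid of norms stops at [gam].

    The discrete functions themselves lie in the ball, so one of the two suprema of the Hausdorff
    distance vanishes.

    Measurability on [R^(2k)] controls the section [K xi] only for almost every [xi], so the
    pointwise estimate holds off a null set. The norm of [F(x)(xi) - F(y)(xi)] is never shown to be
    measurable in [xi]; it is dominated by a measurable function instead. *)

Section euclidean_norm.
Context (R : realType).

Lemma continuous_sum (T : topologicalType) (I : finType) (f : I -> T -> R) :
  (forall i, continuous (f i)) -> continuous (fun x => \sum_i f i x).
Proof.
move=> cf; elim: (index_enum I) => [|i s IH] x.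
  by rewrite (_ : (fun _ => _) = cst 0); [exact: cst_continuous|
    apply/funext => y; rewrite big_nil].
rewrite (_ : (fun _ => _) = f i \+ (fun y => \sum_(j <- s) f j y)).
  by apply: continuousD; [exact: cf|exact: IH].
by apply/funext => y; rewrite big_cons.
Qed.

(** Lagrange's identity: the double sum of the squares [(a i * b j - a j * b i) ^+ 2] is twice the
    gap between the two sides. *)
Lemma sum_mul_sqr_le (I : finType) (a b : I -> R) :
  (\sum_i a i * b i) ^+ 2 <= (\sum_i a i ^+ 2) * (\sum_i b i ^+ 2).
Proof.
have H : 0 <= \sum_i \sum_j (a i * b j - a j * b i) ^+ 2.
  by apply: sumr_ge0 => i _; apply: sumr_ge0 => j _; exact: sqr_ge0.
have E : \sum_i \sum_j (a i * b j - a j * b i) ^+ 2 =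
   ((\sum_i a i ^+ 2) * (\sum_i b i ^+ 2) - (\sum_i a i * b i) ^+ 2) *+ 2.
  have E1 : \sum_i \sum_j a i ^+ 2 * b j ^+ 2 =
      (\sum_i a i ^+ 2) * (\sum_i b i ^+ 2).
    by rewrite mulr_suml; apply: eq_bigr => i _; rewrite mulr_sumr.
  have E2 : \sum_i \sum_j (a i * b i) * (a j * b j) = (\sum_i a i * b i) ^+ 2.
    by rewrite expr2 mulr_suml; apply: eq_bigr => i _; rewrite mulr_sumr.
  have E3 : \sum_i \sum_j a j ^+ 2 * b i ^+ 2 =
      (\sum_i a i ^+ 2) * (\sum_i b i ^+ 2) by rewrite exchange_big.
  rewrite mulrnBl mulr2n -{1}E1 -E3 -E2 -sumrMnl -big_split -sumrB /=.
  apply: eq_bigr => i _; rewrite -sumrMnl -big_split -sumrB /=.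
  by apply: eq_bigr => j _; ring.
by move: H; rewrite E pmulrn_lge0// subr_ge0.
Qed.

Lemma enorm_ge0 m n (A : 'M[R]_(m, n)) : 0 <= enorm A.
Proof. exact: sqrtr_ge0. Qed.

Lemma sqr_enorm m n (A : 'M[R]_(m, n)) : enorm A ^+ 2 = \sum_i \sum_j A i j ^+ 2.
Proof.
by rewrite sqr_sqrtr//; apply: sumr_ge0 => i _; apply: sumr_ge0 => j _; exact: sqr_ge0.
Qed.

Lemma enorm0 m n : enorm (0 : 'M[R]_(m, n)) = 0.
Proof.
rewrite /enorm big1 ?sqrtr0// => i _; rewrite big1// => j _.
by rewrite mxE expr0n.
Qed.

Lemma normr_le_enorm m n (A : 'M[R]_(m, n)) i j : `|A i j| <= enorm A.
Proof.
rewrite -(@ler_pXn2r _ 2)// ?nnegrE ?enorm_ge0// sqr_enorm real_normK ?num_real//.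
rewrite (bigD1 i)//= (bigD1 j)//= -addrA lerDl addr_ge0//.
  by apply: sumr_ge0 => *; exact: sqr_ge0.
by apply: sumr_ge0 => *; apply: sumr_ge0 => *; exact: sqr_ge0.
Qed.

Lemma enorm_eq0 m n (A : 'M[R]_(m, n)) : enorm A = 0 -> A = 0.
Proof.
move=> A0; apply/matrixP => i j; rewrite mxE; apply/eqP.
by rewrite -normr_le0 -A0 normr_le_enorm.
Qed.

Lemma enormZ m n (c : R) (A : 'M[R]_(m, n)) : enorm (c *: A) = `|c| * enorm A.
Proof.
rewrite -sqrtr_sqr /enorm -sqrtrM ?sqr_ge0//; congr Num.sqrt.
rewrite mulr_sumr; apply: eq_bigr => i _; rewrite mulr_sumr; apply: eq_bigr => j _.
by rewrite mxE exprMn.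
Qed.

Lemma enormN m n (A : 'M[R]_(m, n)) : enorm (- A) = enorm A.
Proof. by rewrite -scaleN1r enormZ normrN1 mul1r. Qed.

Lemma enormD m n (A B : 'M[R]_(m, n)) : enorm (A + B) <= enorm A + enorm B.
Proof.
rewrite -(@ler_pXn2r _ 2)// ?nnegrE ?enorm_ge0// ?addr_ge0 ?enorm_ge0//.
rewrite sqrrD !sqr_enorm.
have -> : \sum_i \sum_j (A + B) i j ^+ 2 = \sum_i \sum_j A i j ^+ 2 +
    (\sum_i \sum_j A i j * B i j) *+ 2 + \sum_i \sum_j B i j ^+ 2.
  rewrite -sumrMnl -!big_split; apply: eq_bigr => i _ /=.
  rewrite -sumrMnl -!big_split; apply: eq_bigr => j _ /=.
  by rewrite mxE sqrrD.
rewrite lerD2r lerD2l lerMn2r /=.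
apply: (le_trans (ler_norm _)).
rewrite -(@ler_pXn2r _ 2)// ?nnegrE ?mulr_ge0 ?enorm_ge0//.
rewrite real_normK ?num_real// exprMn !sqr_enorm !pair_big /=.
exact: (sum_mul_sqr_le (fun p => A p.1 p.2) (fun p => B p.1 p.2)).
Qed.

Lemma enormB m n (A B : 'M[R]_(m, n)) : enorm (A - B) <= enorm A + enorm B.
Proof. by rewrite (le_trans (enormD _ _))// enormN. Qed.

Lemma enorm_tr m n (A : 'M[R]_(m, n)) : enorm A^T = enorm A.
Proof.
rewrite /enorm exchange_big; congr Num.sqrt.
by apply: eq_bigr => i _; apply: eq_bigr => j _; rewrite mxE.
Qed.

(** Cauchy-Schwarz on each row of [A]. *)
Lemma enorm_mulmx m n (A : 'M[R]_(m, n)) (u : 'cV[R]_n) :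
  enorm (A *m u) <= enorm A * enorm u.
Proof.
rewrite -(@ler_pXn2r _ 2)// ?nnegrE ?mulr_ge0 ?enorm_ge0// exprMn !sqr_enorm.
rewrite mulr_suml; apply: ler_sum => i _; rewrite big_ord1 mxE.
apply: (le_trans (sum_mul_sqr_le _ _)).
by under [X in _ <= _ * X]eq_bigr do rewrite big_ord1.
Qed.

Definition dot n (u v : 'cV[R]_n) : R := \sum_i u i ord0 * v i ord0.

Lemma dotvv n (u : 'cV[R]_n) : dot u u = enorm u ^+ 2.
Proof. by rewrite sqr_enorm; apply: eq_bigr => i _; rewrite big_ord1 expr2. Qed.

Lemma dotDr n (u v w : 'cV[R]_n) : dot u (v + w) = dot u v + dot u w.
Proof.
by rewrite /dot -big_split; apply: eq_bigr => i _; rewrite mxE mulrDr.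
Qed.

Lemma dotDl n (u v w : 'cV[R]_n) : dot (v + w) u = dot v u + dot w u.
Proof.
by rewrite /dot -big_split; apply: eq_bigr => i _; rewrite mxE mulrDl.
Qed.

Lemma normr_dot_le n (u v : 'cV[R]_n) : `|dot u v| <= enorm u * enorm v.
Proof.
rewrite -(@ler_pXn2r _ 2)// ?nnegrE ?mulr_ge0 ?enorm_ge0//.
rewrite real_normK ?num_real// exprMn !sqr_enorm (le_trans (sum_mul_sqr_le _ _))//.
by under [X in _ <= X * _]eq_bigr do rewrite big_ord1;
  under [X in _ <= _ * X]eq_bigr do rewrite big_ord1.
Qed.

Lemma dot_mulmx m n (u : 'cV[R]_m) (A : 'M[R]_(m, n)) (v : 'cV[R]_n) :
  dot u (A *m v) = dot (A^T *m u) v.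
Proof.
rewrite /dot; under eq_bigr do rewrite mxE mulr_sumr.
rewrite exchange_big; apply: eq_bigr => j _; rewrite mxE mulr_suml.
by apply: eq_bigr => i _; rewrite mxE mulrCA mulrA.
Qed.

Lemma continuous_enorm m n : continuous (@enorm R m n).
Proof.
move=> A; apply: (continuous_comp (f := fun B : 'M[R]_(m, n) => _)).
  apply: continuous_sum => i; apply: continuous_sum => j B.
  apply: (continuous_comp (g := fun x : R => x ^+ 2)); first exact: coord_continuous.
  exact: exprn_continuous.
exact: sqrt_continuous.
Qed.

End euclidean_norm.

(** * Boxes are Lebesgue measurable *)

Section lebesgue_box.
Context (R : realType) (k : nat).
Implicit Types (A : set (Rk_all R k)) (a b x : 'rV[R]_k).

(** [A] followed by empty sets is a cover of [A]. *)
Lemma lebesgue_le_box_weight A : (lebesgue R k A <= box_weight A)%E.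
Proof.
apply: ereal_inf_lbound; exists (fun n => if n is 0%N then A else set0).
  by split=> [//|t At]; exists 0%N.
apply/cvg_lim => //; rewrite -cvg_shiftS.
rewrite (_ : [sequence _]_n = cst (box_weight A)); first exact: cvg_cst.
by rewrite funeqE => n /=; rewrite big_nat_recl//= big1 ?adde0// => i _; exact: box_weight0.
Qed.

Lemma box_weight_hobox a b : (forall i, a 0 i <= b 0 i) ->
  (box_weight (hobox a b : set (Rk_all R k)) <= (box_volume (a, b))%:E)%E.
Proof.
move=> ab; rewrite /box_weight; case: ifPn => _.
  by rewrite lee_fin /box_volume; apply: prodr_ge0 => i _; rewrite subr_ge0.
by apply: ereal_inf_lbound; exists (a, b).
Qed.

(** A hyperplane orthogonal to a coordinate axis cuts a box into two boxes whose volumes add up. If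
    [A] is neither empty nor a box, the right side is the infimum of an empty set, [+oo]. *)
Lemma box_weight_halfspace A (j : 'I_k) (c : R) :
  (box_weight (A `&` [set x : Rk_all R k | (x : 'rV[R]_k) 0 j < c]%R)
   + box_weight (A `&` ~` [set x : Rk_all R k | (x : 'rV[R]_k) 0 j < c]%R)
   <= box_weight A)%E.
Proof.
have [->|A0] := eqVneq A set0.
  by rewrite !set0I box_weight0 adde0.
rewrite [leRHS]/box_weight; destruct (pselect (A = set0)) as [h|h] => /=.
  by rewrite h eqxx in A0.
apply: le_ereal_inf_tmp => _ [[a b] /= [ab ->] <-].
(* The level [c] clamped to the [j]-th side, so that both pieces have ordered corners even when the
   hyperplane misses the box. *)
pose c' := Order.max (a 0 j) (Order.min c (b 0 j)).
pose b' : 'rV[R]_k := \row_i (if i == j then c' else b 0 i).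
pose a' : 'rV[R]_k := \row_i (if i == j then c' else a 0 i).
have ac' : a 0 j <= c' by rewrite /c' le_max lexx.
have cb' : c' <= b 0 j by rewrite /c' ge_max ab ge_min lexx orbT.
have E1 : hobox a b `&` [set x | (x : 'rV[R]_k) 0 j < c] = hobox a b'.
  apply/seteqP; split => x /=.
    move=> [xab xc] i; rewrite mxE; case: eqVneq => [->|_]; last exact: xab.
    have /andP[-> xb] := xab j.
    by rewrite /= /c' lt_max lt_min xc xb orbT.
  move=> xab; split.
    move=> i; have := xab i; rewrite mxE; case: eqVneq => [->|//].
    by move=> /andP[-> /lt_le_trans ->].
  have := xab j; rewrite mxE eqxx => /andP[ax].
  by rewrite /c' lt_max lt_min ltNge ax/= => /andP[].
have E2 : hobox a b `&` ~` [set x | (x : 'rV[R]_k) 0 j < c] = hobox a' b.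
  apply/seteqP; split => x /=.
    move=> [xab xc] i; rewrite mxE; case: eqVneq => [->|_]; last exact: xab.
    have /andP[ax xb] := xab j; rewrite xb andbT /c' ge_max ax /= ge_min.
    by rewrite leNgt; move/negP : xc => ->.
  move=> xab; split.
    move=> i; have := xab i; rewrite mxE; case: eqVneq => [->|//].
    by move=> /andP[/(le_trans ac') -> ->].
  have := xab j; rewrite mxE eqxx => /andP[cx xb].
  apply/negP; rewrite -leNgt; move: cx; rewrite /c' ge_max ge_min => /andP[_].
  by rewrite (leNgt (b 0 j)) xb orbF.
rewrite E1 E2.
apply: (@le_trans _ _ ((box_volume (a, b'))%:E + (box_volume (a', b))%:E)%E).
  apply: leeD; apply: box_weight_hobox => i; rewrite mxE.
    by case: eqVneq => [->|].
  by case: eqVneq => [->|].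
rewrite -EFinD lee_fin /box_volume /= (bigD1 j)//= [X in _ + X](bigD1 j)//=.
rewrite [leRHS](bigD1 j)//= !mxE eqxx.
rewrite (eq_bigr (fun i => b 0 i - a 0 i)); last first.
  by move=> i ij; rewrite mxE (negbTE ij).
rewrite [X in _ + _ * X](eq_bigr (fun i => b 0 i - a 0 i)); last first.
  by move=> i ij; rewrite mxE (negbTE ij).
by rewrite -mulrDl [_ + (b 0 j - c')]addrC addrA subrK.
Qed.

(** Caratheodory's criterion: cutting every set of a cover of [X] by [H] and by its complement
    covers both pieces of [X] without increasing the total weight. *)
Lemma measurable_halfspace (j : 'I_k) (c : R) :
  measurable ([set x | (x : 'rV[R]_k) 0 j < c] : set (Rk R k)).
Proof.
set H := [set x | _].
apply: le_caratheodory_measurable => X.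
apply: le_ereal_inf_tmp => _ [F [mF XF] <-].
apply: (@le_trans _ _ (\sum_(i <oo) (box_weight (F i `&` H)
   + box_weight (F i `&` ~` H)))%E); last first.
  apply: lee_nneseries => [i _ _|i _]; last exact: box_weight_halfspace.
  by apply: adde_ge0; exact: box_weight_ge0.
rewrite nneseriesD; [|by move=> *; exact: box_weight_ge0..].
apply: leeD; apply: ereal_inf_lbound.
  exists (fun i => F i `&` H) => //; split=> // x [/XF[i _ Fi] Hx].
  by exists i.
exists (fun i => F i `&` ~` H) => //; split=> // x [/XF[i _ Fi] Hx].
by exists i.
Qed.

Lemma measurable_hobox a b : measurable (hobox a b : set (Rk R k)).
Proof.
rewrite (_ : hobox a b = \bigcap_(i in [set: 'I_k])
    (~` [set x : Rk R k | (x : 'rV[R]_k) 0 i < a 0 i] `&`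
     [set x | (x : 'rV[R]_k) 0 i < b 0 i])); last first.
  apply/seteqP; split=> [x xab i _|x xab i] /=.
    have /andP[ax xb] := xab i; split=> //; apply/negP.
    by rewrite -leNgt.
  have [/= /negP] := xab i I.
  by rewrite -leNgt => -> ->.
apply: fin_bigcap_measurable => // i _; apply: measurableI.
  by apply: measurableC; exact: measurable_halfspace.
exact: measurable_halfspace.
Qed.

(** Definitionally [lebesgue R k]; the name serves to carry the measure and sigma-finiteness
    instances. *)
Definition leb : set (Rk R k) -> \bar R := lebesgue R k.
Arguments leb : clear implicits.

HB.instance Definition _ := Measure.copy leb (lebesgue R k).

Lemma leb_hobox_le a b : (forall i, a 0 i <= b 0 i) ->
  (leb (hobox a b) <= (box_volume (a, b))%:E)%E.
Proof.
by move=> ab; rewrite (le_trans (lebesgue_le_box_weight _))// box_weight_hobox.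
Qed.

(** Exhaustion by the cubes [[-n, n)^k]; the product measure and Tonelli's theorem rest on it. *)
Lemma leb_sigma_finite : sigma_finite setT leb.
Proof.
exists (fun n => hobox (const_mx (- n%:R)) (const_mx n%:R)).
  apply/esym; rewrite -subTset => x _.
  pose M := \sum_i `|(x : 'rV[R]_k) 0 i|.
  exists (Num.truncn M).+1 => // i; rewrite !mxE.
  have xM : `|(x : 'rV[R]_k) 0 i| < (Num.truncn M).+1%:R.
    rewrite (le_lt_trans _ (truncnS_gt _))//.
    rewrite /M (bigD1 i)//= lerDl; apply: sumr_ge0 => //.
  move: xM; rewrite ltr_norml => /andP[/ltW -> ->//].
move=> n; split; first exact: measurable_hobox.
rewrite (le_lt_trans (leb_hobox_le _)) ?ltry// => i.
by rewrite !mxE lerNl (le_trans (y := 0))// oppr_le0.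
Qed.

HB.instance Definition _ := Measure_isSigmaFinite.Build _ _ _ leb leb_sigma_finite.

End lebesgue_box.
Arguments leb : clear implicits.

(** * Lebesgue sets of R^(2k) and the product measure *)

Section product_approximation.
Context (R : realType) (k : nat).
Local Notation mu := (leb R (k + k)).
Local Notation mu2 := (leb R k \x leb R k)%E.

Definition join_halves (t : Rk R k * Rk R k) : Rk R (k + k) :=
  row_mx (t.1 : 'rV[R]_k) (t.2 : 'rV[R]_k).

Lemma preimage_join_halves_hobox (a b : 'rV[R]_(k + k)) :
  join_halves @^-1` (hobox a b : set (Rk R (k + k))) =
  (hobox (lsubmx a) (lsubmx b) : set (Rk R k)) `*`
  (hobox (rsubmx a) (rsubmx b) : set (Rk R k)).
Proof.
apply/seteqP; split=> [[s t] /= h|[s t] /= [hs ht] i].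
  split=> i; rewrite !mxE.
    by have := h (lshift k i); rewrite /join_halves row_mxEl.
  by have := h (rshift k i); rewrite /join_halves row_mxEr.
case: (split_ordP i) => j ->.
  by have := hs j; rewrite /join_halves row_mxEl !mxE.
by have := ht j; rewrite /join_halves row_mxEr !mxE.
Qed.

(** Finite weight forces [A] to be empty or a box. A box pulls back to a product of two boxes, and
    its volume factors accordingly. *)
Lemma box_weight_join_halves (A : set (Rk R (k + k))) : (box_weight (A : set (Rk_all R _)) < +oo)%E ->
  [/\ measurable A, measurable (join_halves @^-1` A) &
      (mu2 (join_halves @^-1` A) <= box_weight (A : set (Rk_all R _)))%E].
Proof.
rewrite /box_weight; destruct (pselect ((A : set (Rk_all R _)) = set0)) as [h|h] => /=.
  by rewrite h preimage_set0 measure0.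
move=> /ereal_inf_lt[_ [[a b] /= [ab AE] _] _]; split.
- by rewrite AE; exact: measurable_hobox.
- by rewrite AE preimage_join_halves_hobox; apply: measurableX; exact: measurable_hobox.
apply: le_ereal_inf_tmp => _ [[c d] /= [cd ->] <-].
rewrite preimage_join_halves_hobox product_measure1E; try exact: measurable_hobox.
apply: (@le_trans _ _ ((box_volume (lsubmx c, lsubmx d))%:E *
                       (box_volume (rsubmx c, rsubmx d))%:E)%E).
  by apply: lee_pmul; rewrite ?measure_ge0//; apply: leb_hobox_le => i; rewrite !mxE.
rewrite -EFinM lee_fin /box_volume big_split_ord /=.
by under eq_bigr do rewrite !mxE; under [X in _ * X]eq_bigr do rewrite !mxE.
Qed.

(** A single box cover of [X] with total weight below [v] serves both measures, by countable
    subadditivity of each. *)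
Lemma leb_cover (X : set (Rk R (k + k))) (v : \bar R) : (mu X < v)%E ->
  exists U : set (Rk R (k + k)), [/\ measurable U, measurable (join_halves @^-1` U),
    X `<=` U, (mu U < v)%E & (mu2 (join_halves @^-1` U) < v)%E].
Proof.
move=> /ereal_inf_lt[_ [F [_ XF] <-] Fv].
have F0 n : (0 <= box_weight (F n))%E by exact: box_weight_ge0.
have Fy n : (box_weight (F n) < +oo)%E.
  rewrite ltey; apply/eqP => Fny; move: Fv.
  rewrite (@eseries_pinfty _ _ xpredT n)// ?ltNge ?leey// => i _.
  by rewrite -ltNye (lt_le_trans _ (F0 i)).
have mF n : measurable (F n : set (Rk R (k + k))) by case: (box_weight_join_halves (Fy n)).
have mgF n : measurable (join_halves @^-1` (F n : set (Rk R (k + k)))).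
  by case: (box_weight_join_halves (Fy n)).
exists (\bigcup_n F n); split => //.
- exact: bigcup_measurable.
- by rewrite preimage_bigcup; exact: bigcup_measurable.
- apply: le_lt_trans Fv.
  apply: (le_trans (measure_sigma_subadditive mu mF _ _)) => //.
    exact: bigcup_measurable.
  apply: lee_nneseries => // n _; exact: lebesgue_le_box_weight.
- apply: le_lt_trans Fv; rewrite preimage_bigcup.
  apply: (le_trans (measure_sigma_subadditive _ mgF _ _)) => //.
    exact: bigcup_measurable.
  by apply: lee_nneseries => // n _; case: (box_weight_join_halves (Fy n)).
Qed.

(* The G_delta hull of [X] by box covers, simultaneously for both measures. *)
Lemma leb_hull (X : set (Rk R (k + k))) : (mu X < +oo)%E ->
  exists U : set (Rk R (k + k)), [/\ measurable U, measurable (join_halves @^-1` U),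
    X `<=` U, (mu U <= mu X)%E & (mu2 (join_halves @^-1` U) <= mu X)%E].
Proof.
move=> Xoo.
have X0 : (0 <= mu X)%E by exact: outer_measure_ge0.
have Xfin : mu X \is a fin_num by rewrite ge0_fin_numE.
have /choice[U HU] n : exists U : set (Rk R (k + k)), [/\ measurable U,
    measurable (join_halves @^-1` U), X `<=` U, (mu U < mu X + (n.+1%:R^-1)%:E)%E &
    (mu2 (join_halves @^-1` U) < mu X + (n.+1%:R^-1)%:E)%E].
  by apply: leb_cover; rewrite lteDl// lte_fin invr_gt0.
have lim (y : \bar R) : (forall n, y <= mu X + (n.+1%:R^-1)%:E)%E -> (y <= mu X)%E.
  move=> h; apply/lee_addgt0Pr => e e0.
  apply: le_trans (h (Num.truncn e^-1)) _; rewrite leeD2l// lee_fin.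
  by rewrite invf_ple ?posrE// ltW// truncnS_gt.
exists (\bigcap_n U n); split.
- by apply: bigcapT_measurable => n; case: (HU n).
- by rewrite preimage_bigcap; apply: bigcapT_measurable => n; case: (HU n).
- by move=> x Xx n _; case: (HU n) => _ _ + _ _; exact.
- apply: lim => n; case: (HU n) => mU _ _ /ltW h _; apply: le_trans h.
  apply: le_measure; rewrite ?inE//; last exact: bigcap_inf.
  by apply: bigcapT_measurable => i; case: (HU i).
- apply: lim => n; case: (HU n) => _ mU _ _ /ltW h; apply: le_trans h.
  rewrite preimage_bigcap; apply: le_measure; rewrite ?inE//; last exact: bigcap_inf.
  by apply: bigcapT_measurable => i; case: (HU i).
Qed.

(** [E'] comes from the hull [U] of [E], and [P] from the hull of the null set of points in [U] but
    not in [E]: outside [P], belonging to [U] means belonging to [E]. *)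
Lemma leb_approx (E : set (Rk R (k + k))) : measurable E -> (mu E < +oo)%E ->
  exists E' P : set (Rk R k * Rk R k), [/\ measurable E', measurable P,
    mu2 P = 0%E & forall t, ~ P t -> E (join_halves t) <-> E' t].
Proof.
move=> mE Eoo; have [U [mU mgU EU UE _]] := leb_hull Eoo.
have UE0 : mu (U `\` E) = 0%E.
  have Efin : mu E \is a fin_num by rewrite ge0_fin_numE.
  apply/eqP; rewrite eq_le measure_ge0 andbT measureD//; last first.
    exact: le_lt_trans Eoo.
  by rewrite setIidr// leeBlDr// add0e.
have [|P [_ mP UEP _ P0]] := @leb_hull (U `\` E); first by rewrite UE0.
exists (join_halves @^-1` U), (join_halves @^-1` P); split => //.
  by apply/eqP; rewrite eq_le measure_ge0 andbT -UE0.
move=> t nP; split=> [/EU//|Ut].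
by apply: contrapT => nE; apply: nP; apply: UEP.
Qed.

(** A real function is the supremum of the rationals below it. It suffices to replace the countably
    many superlevel sets [f > q] and to collect their exceptional null sets. *)
Lemma measurable_fun_approx (D : set (Rk R (k + k))) (f : Rk R (k + k) -> R) :
  measurable D -> (mu D < +oo)%E -> measurable_fun D f ->
  exists f' : Rk R k * Rk R k -> R, exists P : set (Rk R k * Rk R k),
    [/\ measurable_fun setT f', measurable P, mu2 P = 0%E &
        forall t, ~ P t -> D (join_halves t) -> f (join_halves t) = f' t].
Proof.
move=> mD Doo mf.
have /choice[E' /choice[P HP]] (q : rat) : exists E' P : set (Rk R k * Rk R k),
    [/\ measurable E', measurable P, mu2 P = 0%E &
    forall t, ~ P t -> (D `&` f @^-1` `]ratr q, +oo[) (join_halves t) <-> E' t].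
  have mE : measurable (D `&` f @^-1` `]ratr q, +oo[) by exact: mf.
  apply: leb_approx => //; apply: le_lt_trans Doo.
  by apply: le_measure; rewrite ?inE//; exact: subIsetl.
(* The rational coded by [n] on its replaced superlevel set, and [-oo], neutral for suprema,
   elsewhere; [f'] is the supremum of this sequence. *)
pose h (n : nat) (t : Rk R k * Rk R k) : \bar R :=
  if unpickle n is Some q then
    if t \in E' q then (ratr q)%:E else -oo%E else -oo%E.
have mh n : measurable_fun setT (h n).
  rewrite /h; case: unpickle => [q|//].
  apply: measurable_fun_ifT => //; apply: (measurable_fun_bool true).
  rewrite setTI (_ : _ @^-1` _ = E' q); first by case: (HP q).
  by apply/seteqP; split => t /=; [move/set_mem|move/mem_set].
exists (fun t => fine (esups (h^~ t) 0)).
exists (\bigcup_n (if unpickle n is Some q then P q else set0)); split.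
- apply: measurableT_comp; first exact: fine_measurable.
  exact: measurable_fun_esups.
- by apply: bigcupT_measurable => n; case: unpickle => // q; case: (HP q).
- apply/negligibleP.
    by apply: bigcupT_measurable => n; case: unpickle => // q; case: (HP q).
  apply: negligible_bigcup => n; case: unpickle => [q|]; last exact: negligible_set0.
  by case: (HP q) => _ mP P0 _; apply/negligibleP.
move=> t nP Dt.
have nPq q : ~ P q t.
  move=> Pq; apply: nP; exists (pickle q); first exact: I.
  rewrite pickleK; exact: Pq.
suff -> : esups (h^~ t) 0 = (f (join_halves t))%:E by [].
have E'P q : E' q t <-> ratr q < f (join_halves t).
  case: (HP q) => _ _ _ /(_ t (nPq q)) <- /=; rewrite in_itv/= andbT.
  by split=> [[]|].
apply/eqP; rewrite eq_le; apply/andP; split.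
  apply: ge_ereal_sup => _ [n _ <-]; rewrite /h.
  case: unpickle => [q|]; last by rewrite leNye.
  case: ifPn => [|_]; last by rewrite leNye.
  by move=> /set_mem /E'P /ltW; rewrite lee_fin.
apply/lee_addgt0Pr => e e0.
have [|q] := @rat_in_itvoo R (f (join_halves t) - e) (f (join_halves t)).
  by rewrite ltrBlDr ltrDl.
rewrite in_itv => /andP[q1 q2].
apply: (@le_trans _ _ ((ratr q)%:E + e%:E)%E).
  by rewrite -EFinD lee_fin -lerBlDr ltW.
apply: leeD => //; apply: ereal_sup_ubound.
exists (pickle q); first by [].
rewrite /h pickleK ifT//; apply/mem_set.
exact/E'P.
Qed.

End product_approximation.

(** * Open, closed and compact sets in the Lebesgue sigma-algebra *)

Section Rk_topology.
Context (R : realType).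

(** Around each point of [U] there is a half-open box with rational corners inside [U], because
    balls for the matrix topology are cubes; there are countably many such boxes. *)
Lemma open_measurable_Rk k (U : set 'rV[R]_k) : open U -> measurable (U : set (Rk R k)).
Proof.
move=> oU.
pose box (ab : 'rV[rat]_k * 'rV[rat]_k) : set (Rk R k) :=
  hobox (map_mx ratr ab.1) (map_mx ratr ab.2).
rewrite (_ : (U : set (Rk R k)) =
    \bigcup_ab (if `[< box ab `<=` U >] then box ab else set0)); last first.
  apply/seteqP; split => x; last first.
    by move=> [ab _]; case: asboolP => // abU /abU.
  move=> Ux; have /nbhs_ballP[e /= e0 xeU] : nbhs (x : 'rV[R]_k) U.
    exact: open_nbhs_nbhs.
  have /choice[a Ha] (i : 'I_k) : exists q : rat,
      ratr q \in `](x : 'rV[R]_k) 0 i - e, (x : 'rV[R]_k) 0 i[.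
    by apply: rat_in_itvoo; rewrite ltrBlDr ltrDl.
  have /choice[b Hb] (i : 'I_k) : exists q : rat,
      ratr q \in `](x : 'rV[R]_k) 0 i, (x : 'rV[R]_k) 0 i + e[.
    by apply: rat_in_itvoo; rewrite ltrDl.
  exists (\row_i a i, \row_i b i); first by [].
  case: asboolP => [_|]; last first.
    case=> y yab; apply: xeU; rewrite /ball/= /mx_ball/=; split=> // i j.
    have /andP[ay yb] := yab j; rewrite !mxE in ay yb.
    have /andP[xa ax] := Ha j; have /andP[xb bx] := Hb j.
    rewrite !ord1 /ball/= ltr_distlC; apply/andP; split.
      by apply: lt_le_trans xa ay.
    by apply: lt_trans yb bx.
  move=> i; rewrite !mxE.
  have /andP[xa ax] := Ha i; have /andP[xb bx] := Hb i.
  apply/andP; split; [exact: ltW ax|exact: xb].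
apply: countable_bigcupT_measurable; first exact: countableP.
by move=> ab; case: asboolP => // _; exact: measurable_hobox.
Qed.

(** Relative continuity makes the preimage of an open interval the trace on [D] of an open set,
    which [g] pulls back to an open set. It is used with [g] splitting a vector into halves, and
    with [g s = (xi, s)]. *)
Lemma measurable_fun_comp_within k (T : topologicalType) (D : set T)
    (g : 'rV[R]_k -> T) (f : T -> R) :
  continuous g -> {within D, continuous f} ->
  measurable_fun (g @^-1` D : set (Rk R k)) (f \o g).
Proof.
move=> /continuousP cg /continuousP cf mD.
apply: (measurability _ (RGenOpens.measurableE R)) => //.
move=> _ [_ [a [b ->] <-]].
have /cf/open_subspaceP[V oV VD] := @interval_open R (BRight a) (BLeft b) isT isT.
rewrite (_ : _ `&` _ = (g @^-1` D : set (Rk R k)) `&` (g @^-1` V)).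
  by apply: measurableI => //; apply: open_measurable_Rk; exact: cg.
apply/seteqP; split => x [Dx] fx; split => //.
  have : (V `&` D) (g x) by rewrite VD; split.
  by case.
have : (f @^-1` `]a, b[ `&` D) (g x) by rewrite -VD; split.
by case.
Qed.

Lemma compact_within_bounded (T : topologicalType) (D : set T) (f : T -> R) :
  {within D, continuous f} -> compact D -> exists M, forall x, D x -> `|f x| <= M.
Proof.
move=> cf cD; have /compact_bounded[M [_ HM]] := continuous_compact cf cD.
exists (M + 1) => x Dx; apply: (HM (M + 1)); first by rewrite ltrDl.
by exists x.
Qed.

Lemma bounded_leb_lty k (D : set (Rk R k)) (M : R) :
  (forall x, D x -> forall i, `|(x : 'rV[R]_k) 0 i| <= M) -> (leb R k D < +oo)%E.
Proof.
move=> HM.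
pose B : set (Rk R k) := hobox (const_mx (- `|M| - 1)) (const_mx (`|M| + 1)).
apply: (@le_lt_trans _ _ (leb R k B)).
  apply: le_outer_measure => x Dx i; rewrite !mxE.
  have : `|(x : 'rV[R]_k) 0 i| < `|M| + 1.
    rewrite (le_lt_trans (HM x Dx i))// (le_lt_trans (ler_norm _))//.
    by rewrite ltrDl.
  by rewrite ltr_norml opprD => /andP[/ltW -> ->].
rewrite (le_lt_trans (leb_hobox_le _)) ?ltry// => i; rewrite !mxE.
by rewrite -opprD ge0_cp//; rewrite addr_ge0.
Qed.

Lemma compact_entry_bounded k (D : set 'rV[R]_k) : compact D ->
  exists M, forall x, D x -> forall i, `|x 0 i| <= M.
Proof.
move=> cD.
have [|M HM] := @compact_within_bounded _ D (@enorm R 1 k) _ cD.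
  by apply: continuous_subspaceT; exact: continuous_enorm.
exists M => x /HM xM i; apply: le_trans (normr_le_enorm _ _ _) _.
exact: le_trans (ler_norm _) xM.
Qed.

Lemma closed_measurable_Rk k (D : set 'rV[R]_k) : closed D ->
  measurable (D : set (Rk R k)).
Proof.
move=> cD; rewrite -[D]setCK; apply: measurableC; apply: open_measurable_Rk.
exact: closed_openC.
Qed.

(** Inverse to [join_halves]; the preimage of the square of [Om] under it unfolds to the domain that
    occurs in [lmeasurable_kernel]. *)
Definition halves k (z : 'rV[R]_(k + k)) : 'rV[R]_k * 'rV[R]_k := (lsubmx z, rsubmx z).
Arguments halves {k}.

Lemma continuous_halves k : continuous (@halves k).
Proof.
move=> z; apply: (@cvg_pair _ _ _ (nbhs z) (nbhs (lsubmx z)) (nbhs (rsubmx z))).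
  exact: continuous_lsubmx.
exact: continuous_rsubmx.
Qed.

Section square.
Variables (k : nat) (Om : set 'rV[R]_k).
Hypothesis cOm : compact Om.

Lemma measurable_square : measurable (halves @^-1` (Om `*` Om) : set (Rk R (k + k))).
Proof.
have cl : closed Om := compact_closed (@norm_hausdorff R _) cOm.
rewrite (_ : halves @^-1` _ = (lsubmx @^-1` Om) `&` (rsubmx @^-1` Om))//.
apply: measurableI; apply: closed_measurable_Rk; apply: preimage_closed => // z _.
  exact: continuous_lsubmx.
exact: continuous_rsubmx.
Qed.

Lemma square_lty :
  (leb R (k + k) (halves @^-1` (Om `*` Om) : set (Rk R (k + k))) < +oo)%E.
Proof.
have [M HM] := compact_entry_bounded cOm.
apply: (@bounded_leb_lty _ _ M) => z [/= /HM lz /HM rz] i.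
by case: (split_ordP i) => j ->; [have := lz j|have := rz j]; rewrite mxE.
Qed.

End square.

End Rk_topology.
Arguments halves {R k}.

(** * Lower integrals, Hoelder and Minkowski *)

Section integral_complements.
Context d (T : measurableType d) (R : realType) (mu : {measure set T -> \bar R}).
Import HBNNSimple.
Local Open Scope ereal_scope.

(* Holds for the integral of arbitrary nonnegative functions, because it is a
   supremum over the simple functions below; no measurability is needed. *)
Lemma le_integral_ae (D N : set T) (f g : T -> \bar R) :
  measurable N -> mu N = 0 ->
  (forall x, D x -> 0 <= f x) -> (forall x, D x -> 0 <= g x) ->
  (forall x, D x -> ~ N x -> f x <= g x) ->
  \int[mu]_(x in D) f x <= \int[mu]_(x in D) g x.
Proof.
move=> mN N0 f0 g0 fg; rewrite !ge0_integralE//.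
apply: ge_ereal_sup => _ [h hf <-].
have mCN : measurable (~` N) by exact: measurableC.
suff -> : sintegral mu h = sintegral mu (proj_nnsfun h mCN).
  apply: ereal_sup_ubound; exists (proj_nnsfun h mCN) => // x.
  rewrite -mrestrict patchE; case: ifPn => [|_].
    rewrite inE => nNx; apply: (le_trans (hf x)).
    rewrite !patchE; case: ifPn => // /set_mem Dx; exact: fg.
  by apply: erestrict_ge0.
rewrite -!integralT_nnsfun.
rewrite (ge0_negligible_integral mN _ _ _ N0)//; last 2 first.
  by apply/measurable_EFinP.
  by move=> x _; rewrite lee_fin.
rewrite [RHS](ge0_negligible_integral mN _ _ _ N0)//; last 2 first.
  by apply/measurable_EFinP.
  by move=> x _; rewrite lee_fin.
apply: eq_integral => x; rewrite inE => -[_ nNx].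
by rewrite -mrestrict patchE ifT// inE.
Qed.

Lemma le_integral_ge0 (D : set T) (f g : T -> \bar R) :
  (forall x, D x -> 0 <= f x) -> (forall x, D x -> f x <= g x) ->
  \int[mu]_(x in D) f x <= \int[mu]_(x in D) g x.
Proof.
move=> f0 fg; apply: (@le_integral_ae D set0) => // [x Dx|x Dx _]; last exact: fg.
by apply: le_trans (fg x Dx); exact: f0.
Qed.

(** By completeness, the part of the preimage inside [N] is measurable whatever [f] does there. *)
Lemma measurable_fun_ae_eq (D N : set T) (f g : T -> R) :
  measure_is_complete mu -> mu.-negligible N -> measurable_fun D g ->
  (forall x, D x -> ~ N x -> f x = g x) -> measurable_fun D f.
Proof.
move=> cmu nN mg fg mD Y mY.
rewrite (_ : _ `&` _ = ((D `&` g @^-1` Y) `\` N) `|` ((D `&` f @^-1` Y) `&` N)).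
  apply: measurableU.
    by apply: measurableD; [exact: mg|exact: cmu].
  by apply: cmu; apply: negligibleS nN; exact: subIsetr.
apply/seteqP; split => x /=.
  move=> [Dx Yx]; have [Nx|nNx] := pselect (N x); first by right.
  by left; split => //; split=> //=; rewrite -fg.
by move=> [[[Dx Yx] nNx]|[]//]; split => //; rewrite fg.
Qed.

Lemma powR_patch (D : set T) (f : T -> R) (p : R) : (0 < p)%R ->
  (fun x => (`|(f \_ D) x| `^ p)%:E) = (fun x => (`|f x| `^ p)%:E) \_ D.
Proof.
move=> p0; apply/funext => x; rewrite !patchE; case: ifPn => // _.
by rewrite normr0 powR0// gt_eqF.
Qed.

(** Extension by zero leaves the integral of the [p]-th power unchanged; this carries Hoelder and
    Minkowski from the whole space to [D]. *)
Lemma Lnorm_patch (D : set T) (f : T -> R) (p : R) : (0 < p)%R ->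
  'N[mu]_p%:E[EFin \o (f \_ D)] =
  (\int[mu]_(x in D) (`|f x| `^ p)%:E) `^ p^-1.
Proof.
by move=> p0; rewrite unlock [in RHS]integral_mkcond -powR_patch.
Qed.

Lemma hoelder_in (D : set T) (f g : T -> R) (p q : R) : measurable D ->
  measurable_fun D f -> measurable_fun D g ->
  (forall x, D x -> 0 <= f x)%R -> (forall x, D x -> 0 <= g x)%R ->
  (0 < p)%R -> (0 < q)%R -> (p^-1 + q^-1 = 1)%R ->
  \int[mu]_(x in D) (f x * g x)%:E <=
  (\int[mu]_(x in D) (f x `^ p)%:E) `^ p^-1 *
  (\int[mu]_(x in D) (g x `^ q)%:E) `^ q^-1.
Proof.
move=> mD mf mg f0 g0 p0 q0 pq.
have mfD : measurable_fun setT (f \_ D) by exact/(measurable_restrictT _ mD).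
have mgD : measurable_fun setT (g \_ D) by exact/(measurable_restrictT _ mD).
have := hoelder mu mfD mgD p0 q0 pq.
rewrite (Lnorm_patch _ _ p0) (Lnorm_patch _ _ q0) Lnorm1.
rewrite (eq_integral ((fun x => (f x * g x)%:E) \_ D)); last first.
  move=> x _ /=; rewrite !patchE; case: ifPn => [/set_mem Dx|_].
    by rewrite ger0_norm// mulr_ge0 ?f0 ?g0.
  by rewrite mulr0 normr0.
rewrite -integral_mkcond => /le_trans; apply.
apply: lee_pmul; [exact: poweR_ge0|exact: poweR_ge0| |].
  by rewrite (eq_integral (fun x => (f x `^ p)%:E))// => x /set_mem Dx; rewrite ger0_norm// f0.
by rewrite (eq_integral (fun x => (g x `^ q)%:E))// => x /set_mem Dx; rewrite ger0_norm// g0.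
Qed.

Lemma minkowski_in (D : set T) (f g : T -> R) (p : R) : measurable D ->
  measurable_fun D f -> measurable_fun D g ->
  (forall x, D x -> 0 <= f x)%R -> (forall x, D x -> 0 <= g x)%R -> (1 <= p)%R ->
  (\int[mu]_(x in D) ((f x + g x) `^ p)%:E) `^ p^-1 <=
  (\int[mu]_(x in D) (f x `^ p)%:E) `^ p^-1 +
  (\int[mu]_(x in D) (g x `^ p)%:E) `^ p^-1.
Proof.
move=> mD mf mg f0 g0 p1.
have p0 : (0 < p)%R by exact: lt_le_trans p1.
have mfD : measurable_fun setT (f \_ D) by exact/(measurable_restrictT _ mD).
have mgD : measurable_fun setT (g \_ D) by exact/(measurable_restrictT _ mD).
have := minkowski mu mfD mgD p1.
pose fD := f \_ D; pose gD := g \_ D; pose fgD := (f \+ g)%R \_ D.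
have -> : (fD \+ gD)%R = fgD.
  apply/funext => x; rewrite /fD /gD /fgD /= !patchE; case: ifPn => //= _.
  exact: addr0.
rewrite /fgD /fD /gD.
rewrite !(Lnorm_patch _ _ p0).
have normE (h : T -> R) : (forall x, D x -> 0 <= h x)%R ->
    \int[mu]_(x in D) (`|h x| `^ p)%:E = \int[mu]_(x in D) (h x `^ p)%:E.
  by move=> h0; apply: eq_integral => x /set_mem Dx; rewrite ger0_norm// h0.
by rewrite !normE// => x Dx; rewrite /= addr_ge0 ?f0 ?g0.
Qed.

Section finite_partition.
Variables (N : nat) (D : set T) (P : 'I_N -> set T).
Hypothesis mP : forall i, measurable (P i).
Hypothesis disjP : forall i j, i != j -> P i `&` P j = set0.
Hypothesis covP : \bigcup_(i in [set: 'I_N]) P i = D.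

Lemma patch_partition (f : T -> \bar R) : f \_ D = fun x => \sum_i (f \_ (P i)) x.
Proof.
apply/funext => x; rewrite patchE; case: ifPn => [/set_mem|/negP nDx].
  rewrite -covP => -[i _ Pix]; rewrite (bigD1 i)//= big1 ?adde0 => [|j ji].
    by rewrite patchE ifT// inE.
  rewrite patchE ifN//; apply/negP => /set_mem Pjx.
  by have : set0 x by rewrite -(disjP ji); split.
rewrite big1// => i _; rewrite patchE ifN//; apply/negP => /set_mem Pix.
by apply: nDx; apply/mem_set; rewrite -covP; exists i.
Qed.

Lemma ge0_integral_partition (f : T -> \bar R) : measurable_fun D f ->
  (forall x, D x -> 0 <= f x) ->
  \int[mu]_(x in D) f x = \sum_i \int[mu]_(x in P i) f x.
Proof.
move=> mf f0; rewrite integral_mkcond patch_partition ge0_integral_sum//.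
- by apply: eq_bigr => i _; rewrite -integral_mkcond.
- move=> i; apply/(measurable_restrictT _ (mP i)).
  apply: measurable_funS mf; first by rewrite -covP; exact: fin_bigcup_measurable.
  by rewrite -covP => x Px; exists i.
- move=> i x _; rewrite patchE; case: ifPn => // /set_mem Pix; apply: f0.
  by rewrite -covP; exists i.
Qed.

Lemma integral_partition (f : T -> R) : mu.-integrable D (EFin \o f) ->
  (\int[mu]_(x in D) f x = \sum_i \int[mu]_(x in P i) f x)%R.
Proof.
move=> If; have mD : measurable D by rewrite -covP; exact: fin_bigcup_measurable.
have IP i : mu.-integrable (P i) (EFin \o f).
  by apply: integrableS If => //; rewrite -covP => x Px; exists i.
rewrite /Rintegral integral_mkcond patch_partition integral_sum//; last first.
  by move=> i; exact/(integrable_mkcond _ (mP i)).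
rewrite -sum_fine; last first.
  by move=> i _; rewrite -integral_mkcond; exact: integrable_fin_num.
by apply: eq_bigr => i _; rewrite -integral_mkcond.
Qed.

End finite_partition.

End integral_complements.

(** * Integrals of vector functions *)

Section vector_integral.
Context d (T : measurableType d) (R : realType) (mu : {measure set T -> \bar R}).
Implicit Types (A D : set T).

Definition vmeasurable n D (v : T -> 'cV[R]_n) :=
  forall j, measurable_fun D (fun s => v s j ord0).

(** Componentwise, so that [HS Om K x xi] unfolds to the [vint] of [K xi s *m x s]. *)
Definition vint n D (v : T -> 'cV[R]_n) : 'cV[R]_n :=
  \col_i (\int[mu]_(s in D) v s i ord0).

Lemma integrable_dominated D (f g : T -> R) : measurable D ->
  measurable_fun D f -> (forall x, D x -> `|f x| <= g x) ->
  mu.-integrable D (EFin \o g) -> mu.-integrable D (EFin \o f).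
Proof.
move=> mD mf fg; apply: le_integrable => //; first exact/measurable_EFinP.
by move=> x Dx; rewrite /= lee_fin (le_trans (fg x Dx))// ler_norm.
Qed.

Lemma integrable_bounded D (f : T -> R) (c : R) : measurable D ->
  (mu D < +oo)%E -> measurable_fun D f -> (forall x, D x -> `|f x| <= c) ->
  mu.-integrable D (EFin \o f).
Proof.
move=> mD Doo mf fc; apply: (integrable_dominated mD mf fc).
apply: (measurable_bounded_integrable (f := cst c)) => //.
exists `|c|; split; first exact: num_real.
by move=> M cM x _; exact: ltW.
Qed.

Lemma measurable_enorm D m n (A : T -> 'M[R]_(m, n)) :
  (forall i j, measurable_fun D (fun s => A s i j)) ->
  measurable_fun D (fun s => enorm (A s)).
Proof.
move=> mA.
apply: (measurableT_comp (f := @Num.sqrt R)).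
  by apply: continuous_measurable_fun; exact: sqrt_continuous.
apply: measurable_sum => i; apply: measurable_sum => j.
exact: measurable_funX.
Qed.

Lemma measurable_venorm D n (v : T -> 'cV[R]_n) :
  vmeasurable D v -> measurable_fun D (fun s => enorm (v s)).
Proof. by move=> mv; apply: measurable_enorm => i j; rewrite !ord1; exact: mv. Qed.

Lemma measurable_dot D n (u v : T -> 'cV[R]_n) :
  vmeasurable D u -> vmeasurable D v -> measurable_fun D (fun s => dot (u s) (v s)).
Proof.
by move=> mu_ mv; apply: measurable_sum => i; apply: measurable_funM.
Qed.

Lemma vmeasurable_mulmx D m n (A : T -> 'M[R]_(m, n)) (v : T -> 'cV[R]_n) :
  (forall i j, measurable_fun D (fun s => A s i j)) -> vmeasurable D v ->
  vmeasurable D (fun s => A s *m v s).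
Proof.
move=> mA mv i; under eq_fun do rewrite mxE.
by apply: measurable_sum => j; apply: measurable_funM.
Qed.

Lemma vmeasurableB D n (u v : T -> 'cV[R]_n) :
  vmeasurable D u -> vmeasurable D v -> vmeasurable D (fun s => u s - v s).
Proof. by move=> mu_ mv j; under eq_fun do rewrite !mxE; exact: measurable_funB. Qed.

Lemma vmeasurable_cst D n (u : 'cV[R]_n) : vmeasurable D (fun=> u).
Proof. by move=> j; exact: measurable_cst. Qed.

Lemma vmeasurableS D A n (u : T -> 'cV[R]_n) : measurable D -> A `<=` D ->
  vmeasurable D u -> vmeasurable A u.
Proof. by move=> mD AD mu_ j; apply: measurable_funS (mu_ j). Qed.

Section fixed_domain.
Variables (D : set T) (mD : measurable D).

Lemma integrable_entry n (v : T -> 'cV[R]_n) i : vmeasurable D v ->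
  mu.-integrable D (EFin \o (fun s => enorm (v s))) ->
  mu.-integrable D (EFin \o (fun s => v s i ord0)).
Proof.
by move=> mv; apply: integrable_dominated => // x _; exact: normr_le_enorm.
Qed.

Lemma integrable_dot n (u : 'cV[R]_n) (v : T -> 'cV[R]_n) : vmeasurable D v ->
  mu.-integrable D (EFin \o (fun s => enorm (v s))) ->
  mu.-integrable D (EFin \o (fun s => dot u (v s))).
Proof.
move=> mv iv; apply: (@integrable_dominated _ _ (fun s => enorm u * enorm (v s))) => //.
- by apply: measurable_dot => //; exact: vmeasurable_cst.
- by move=> s _; exact: normr_dot_le.
- by have := integrableZl mD (enorm u) iv.
Qed.

Lemma dot_vint n (u : 'cV[R]_n) (v : T -> 'cV[R]_n) : vmeasurable D v ->
  mu.-integrable D (EFin \o (fun s => enorm (v s))) ->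
  dot u (vint D v) = \int[mu]_(s in D) dot u (v s).
Proof.
move=> mv iv.
have I i : mu.-integrable D (fun s => (u i ord0 * v s i ord0)%:E).
  by have := integrableZl mD (u i ord0) (integrable_entry i mv iv).
rewrite /Rintegral; under eq_integral do rewrite /dot -sumEFin.
rewrite integral_sum// -sum_fine; last by move=> i _; exact: integrable_fin_num.
apply: eq_bigr => i _; rewrite mxE -RintegralZl//.
exact: integrable_entry.
Qed.

(* Test the integral against itself. *)
Lemma enorm_vint_le n (v : T -> 'cV[R]_n) : vmeasurable D v ->
  mu.-integrable D (EFin \o (fun s => enorm (v s))) ->
  enorm (vint D v) <= \int[mu]_(s in D) enorm (v s).
Proof.
move=> mv iv; set u := vint D v.
have [u0|] := eqVneq (enorm u) 0.
  by rewrite u0; apply: Rintegral_ge0 => x _; exact: enorm_ge0.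
rewrite neq_lt ltNge enorm_ge0/= => u0.
rewrite -(ler_pM2l u0) -expr2 -dotvv {2}/u dot_vint// -RintegralZl//.
apply: le_Rintegral => //; first exact: integrable_dot.
  by have := integrableZl mD (enorm u) iv.
by move=> s _; apply: le_trans (normr_dot_le _ _); exact: ler_norm.
Qed.

Lemma vintB n (u v : T -> 'cV[R]_n) : vmeasurable D u -> vmeasurable D v ->
  mu.-integrable D (EFin \o (fun s => enorm (u s))) ->
  mu.-integrable D (EFin \o (fun s => enorm (v s))) ->
  vint D u - vint D v = vint D (fun s => u s - v s).
Proof.
move=> mu_ mv iu iv; apply/matrixP => i j; rewrite !mxE.
rewrite -RintegralB//; [|exact: integrable_entry..].
by apply: eq_Rintegral => s _; rewrite !mxE.
Qed.

End fixed_domain.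

Section average.
Variables (A : set T) (mA : measurable A) (Aoo : (mu A < +oo)%E).

Definition average n (v : T -> 'cV[R]_n) : 'cV[R]_n := (fine (mu A))^-1 *: vint A v.

Lemma fine_measureK : (fine (mu A))%:E = mu A.
Proof. by rewrite fineK// ge0_fin_numE. Qed.

(** Null cells are covered: there [0^-1 = 0] makes the average zero, and the integral vanishes as
    well. *)
Lemma scale_average n (v : T -> 'cV[R]_n) : vmeasurable A v ->
  fine (mu A) *: average v = vint A v.
Proof.
move=> mv; rewrite scalerA; have [A0|A0] := eqVneq (fine (mu A)) 0; last first.
  by rewrite mulfV// scale1r.
have muA0 : mu A = 0%E by rewrite -fine_measureK A0.
rewrite A0 mul0r scale0r; apply/matrixP => i j; rewrite !mxE.
rewrite /Rintegral (_ : (\int[mu]_(s in A) _)%E = 0%E)//.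
apply/eqP; rewrite -abse_eq0 eq_le abse_ge0 andbT.
rewrite -(@integral_abs_eq0 _ _ _ mu A (fun s => (v s i ord0)%:E))//.
  by apply: le_abse_integral => //; exact/measurable_EFinP.
exact/measurable_EFinP.
Qed.

Lemma enorm_average_le n (v : T -> 'cV[R]_n) : vmeasurable A v ->
  mu.-integrable A (EFin \o (fun s => enorm (v s))) ->
  fine (mu A) * enorm (average v) <= \int[mu]_(s in A) enorm (v s).
Proof.
move=> mv iv; apply: le_trans (enorm_vint_le mA mv iv).
by rewrite -(scale_average mv) [leRHS]enormZ ger0_norm// fine_ge0.
Qed.

Lemma hoelder_cst1 (f : T -> R) (p q : R) : measurable_fun A f ->
  (forall x, A x -> 0 <= f x) -> 0 < p -> 0 < q -> p^-1 + q^-1 = 1 ->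
  (\int[mu]_(x in A) (f x)%:E <=
  (\int[mu]_(x in A) (f x `^ p)%:E) `^ p^-1 * (mu A) `^ q^-1)%E.
Proof.
move=> mf f0 p0 q0 pq.
have E1 : (\int[mu]_(x in A) ((cst 1 x : R) `^ q)%:E = mu A)%E.
  under eq_integral do rewrite /= powR1.
  by rewrite integral_cst// mul1e.
have := @hoelder_in _ _ _ mu A f (cst 1) p q mA mf (measurable_cst _) f0
  (fun=> fun=> ler01) p0 q0 pq.
by rewrite E1; under eq_integral do rewrite /= mulr1.
Qed.

(** Jensen's inequality, from Hoelder against the constant 1: [mu(A) |av| <= J^(1/p) mu(A)^(1/q)].
    Writing [mu(A) = mu(A)^(1/p) mu(A)^(1/q)], cancelling and raising to the power [p] gives the
    claim. *)
Lemma powR_enorm_average_le n (v : T -> 'cV[R]_n) (p q : R) : vmeasurable A v ->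
  mu.-integrable A (EFin \o (fun s => enorm (v s))) ->
  0 < p -> 0 < q -> p^-1 + q^-1 = 1 ->
  (mu A * (enorm (average v) `^ p)%:E <=
   \int[mu]_(s in A) (enorm (v s) `^ p)%:E)%E.
Proof.
move=> mv iv p0 q0 pq; set J := (\int[mu]_(s in A) _)%E.
have J0 : (0 <= J)%E by apply: integral_ge0 => s _; rewrite lee_fin powR_ge0.
have [muA0|muA0] := eqVneq (mu A) 0%E; first by rewrite muA0 mul0e.
have [->|Jy] := eqVneq J +oo%E; first by rewrite leey.
have Jfin : J \is a fin_num by rewrite ge0_fin_numE// ltey.
have muA : 0 < fine (mu A) by rewrite fine_gt0// Aoo andbT lt0e muA0 measure_ge0.
have H : (fine (mu A) `^ p^-1 * enorm (average v) <= fine J `^ p^-1).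
  have H1 := enorm_average_le mv iv.
  have := @hoelder_cst1 (fun s => enorm (v s)) p q (measurable_venorm mv)
    (fun s _ => enorm_ge0 _) p0 q0 pq.
  rewrite -/J -(fineK Jfin) -fine_measureK !poweR_EFin -EFinM.
  rewrite -(fineK (integrable_fin_num mA iv)) lee_fin => /(le_trans H1).
  rewrite -[in leLHS](powRr1 (ltW muA)) -pq powRD; last first.
    by rewrite pq oner_eq0.
  by rewrite mulrAC ler_pM2r// powR_gt0.
rewrite -fine_measureK -(fineK Jfin) -EFinM lee_fin.
have := @ge0_ler_powR R p (ltW p0) _ _ _ _ H.
rewrite powRM ?powR_ge0 ?enorm_ge0// -!powRrM mulVf ?gt_eqF//.
rewrite !powRr1 ?fine_ge0//.
by apply; rewrite nnegrE ?mulr_ge0 ?powR_ge0 ?enorm_ge0.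
Qed.

End average.

End vector_integral.

(** * Approximation by step functions *)

Section step_approximation.
Context d (T : measurableType d) (R : realType) (mu : {measure set T -> \bar R}).
Variables (N : nat) (D : set T) (P : 'I_N -> set T).
Hypothesis mP : forall i, measurable (P i).
Hypothesis disjP : forall i j, i != j -> P i `&` P j = set0.
Hypothesis covP : \bigcup_(i in [set: 'I_N]) P i = D.
Hypothesis Doo : (mu D < +oo)%E.
Variables (n : nat) (p q r gam : R).
Hypotheses (p1 : 1 < p) (pq : p^-1 + q^-1 = 1) (r0 : 0 < r) (gam0 : 0 < gam).

Let p0 : 0 < p. Proof. by rewrite (lt_trans _ p1). Qed.

Let q0 : 0 < q.
Proof.
rewrite -invr_gt0; have -> : q^-1 = 1 - p^-1 by rewrite -pq addrC addKr.
by rewrite subr_gt0 invf_lt1.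
Qed.

Let mD : measurable D.
Proof. by rewrite -covP; exact: fin_bigcup_measurable. Qed.

Let PD i : P i `<=` D. Proof. by rewrite -covP => s Ps; exists i. Qed.

Let Poo i : (mu (P i) < +oo)%E.
Proof. by apply: le_lt_trans Doo; apply: le_measure; rewrite ?inE. Qed.

Lemma vmeasurable_partition (y : T -> 'cV[R]_n) :
  (forall i, vmeasurable (P i) y) -> vmeasurable D y.
Proof.
move=> my j _ Y mY.
rewrite (_ : _ `&` _ = \bigcup_(i in [set: 'I_N]) (P i `&` (fun s => y s j ord0) @^-1` Y)).
  by apply: fin_bigcup_measurable => // i _; exact: my.
rewrite -covP; apply/seteqP; split => s /=.
  by move=> [[i _ Pis] Ys]; exists i.
by move=> [i _ [Pis Ys]]; split => //; exists i.
Qed.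

Lemma vmeasurable_step (y : T -> 'cV[R]_n) (v : 'I_N -> 'cV[R]_n) :
  (forall i s, P i s -> y s = v i) -> vmeasurable D y.
Proof.
move=> yv; apply: vmeasurable_partition => i j.
apply: (eq_measurable_fun (fun=> v i j ord0)); last exact: measurable_cst.
by move=> s /set_mem /yv ->.
Qed.

Section function.
Variable x : T -> 'cV[R]_n.
Hypothesis mx : vmeasurable D x.
Hypothesis xr : (\int[mu]_(s in D) (enorm (x s) `^ p)%:E <= (r `^ p)%:E)%E.

Let menx : measurable_fun D (fun s => enorm (x s)).
Proof. exact: measurable_venorm. Qed.

Let menxp : measurable_fun D (fun s => enorm (x s) `^ p).
Proof. exact: (measurableT_comp (measurable_powR p) menx). Qed.

Lemma integrable_powR_enorm :
  mu.-integrable D (EFin \o (fun s => enorm (x s) `^ p)).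
Proof.
apply/integrableP; split; first exact/measurable_EFinP.
apply: le_lt_trans (ltry (r `^ p)); apply: le_trans xr.
by apply: le_integral_ge0 => [s _|s _]; rewrite /= ?lee_fin ?normr_ge0// ger0_norm ?powR_ge0.
Qed.

Lemma integral_enorm_le :
  (\int[mu]_(s in D) (enorm (x s))%:E <= (r * fine (mu D) `^ q^-1)%:E)%E.
Proof.
have H := hoelder_cst1 mu mD menx (fun s _ => enorm_ge0 (x s)) p0 q0 pq.
apply: (le_trans H).
rewrite -(fine_measureK Doo) poweR_EFin EFinM.
apply: lee_wpmul2r; first by rewrite lee_fin powR_ge0.
rewrite (_ : r%:E = (r `^ p)%:E `^ p^-1)%E; last first.
  by rewrite poweR_EFin -powRrM mulfV ?gt_eqF// powRr1// ltW.
apply: gt0_ler_poweR => //; first by rewrite invr_ge0 ltW.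
  rewrite in_itv /= leey andbT; apply: integral_ge0 => s _.
  by rewrite lee_fin powR_ge0.
by rewrite in_itv /= leey andbT lee_fin powR_ge0.
Qed.

Lemma integrable_enorm : mu.-integrable D (EFin \o (fun s => enorm (x s))).
Proof.
apply/integrableP; split; first exact/measurable_EFinP.
apply: le_lt_trans (ltry (r * fine (mu D) `^ q^-1)); apply: le_trans integral_enorm_le.
by apply: le_integral_ge0 => [s _|s _]; rewrite /= ?lee_fin ?normr_ge0// ger0_norm ?enorm_ge0.
Qed.

Lemma Rintegral_enorm_le :
  \int[mu]_(s in D) enorm (x s) <= r * fine (mu D) `^ q^-1.
Proof.
by rewrite -lee_fin (fineK (integrable_fin_num mD integrable_enorm)) integral_enorm_le.
Qed.

Lemma Rintegral_powR_enorm_le : \int[mu]_(s in D) (enorm (x s) `^ p) <= r `^ p.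
Proof.
by rewrite -lee_fin (fineK (integrable_fin_num mD integrable_powR_enorm)).
Qed.

(** Values of norm above [gam] become 0, so that cell averages have norm at most [gam], the range of
    the grid. *)
Definition trunc s : 'cV[R]_n := if enorm (x s) <= gam then x s else 0.

Lemma vmeasurable_trunc : vmeasurable D trunc.
Proof.
move=> j.
rewrite (_ : (fun s => _) = (fun s => if enorm (x s) <= gam then x s j ord0 else 0)).
  apply: measurable_fun_if => //.
  - exact: measurable_fun_ler.
  - by apply: measurable_funS (mx j).
by apply/funext => s; rewrite /trunc; case: ifP => // _; rewrite mxE.
Qed.

Lemma enorm_trunc_le_gam s : enorm (trunc s) <= gam.
Proof. by rewrite /trunc; case: ifP => // _; rewrite enorm0 ltW. Qed.

Lemma enorm_trunc_le s : enorm (trunc s) <= enorm (x s).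
Proof. by rewrite /trunc; case: ifP => // _; rewrite enorm0 enorm_ge0. Qed.

(** Where the truncation acts, [|x|^(p-1) >= gam^(p-1)]; elsewhere the left side is 0. *)
Lemma enorm_sub_trunc_le s :
  enorm (x s - trunc s) <= enorm (x s) `^ p / gam `^ (p - 1).
Proof.
have gp0 : 0 < gam `^ (p - 1) by exact: powR_gt0.
rewrite /trunc; case: (leP (enorm (x s)) gam) => xg.
  by rewrite subrr enorm0 divr_ge0 ?powR_ge0.
rewrite subr0 ler_pdivlMr// -(mulr_powRB1 (enorm_ge0 _) p0).
rewrite ler_wpM2l ?enorm_ge0// ge0_ler_powR ?nnegrE ?enorm_ge0// ?subr_ge0 ?ltW//.
Qed.

Lemma integrable_trunc i : mu.-integrable (P i) (EFin \o (fun s => enorm (trunc s))).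
Proof.
apply: (@integrable_bounded _ _ _ _ _ _ gam) => //.
  by apply: measurable_venorm; apply: vmeasurableS vmeasurable_trunc => //; exact: PD.
by move=> s _; rewrite ger0_norm ?enorm_ge0// enorm_trunc_le_gam.
Qed.

Let a i := average mu (P i) trunc.

Let mtrunc i : vmeasurable (P i) trunc.
Proof. by apply: vmeasurableS vmeasurable_trunc => //; exact: PD. Qed.

Lemma enorm_average_trunc_le i : enorm (a i) <= gam.
Proof.
have [A0|A0] := eqVneq (fine (mu (P i))) 0.
  by rewrite /a /average A0 invr0 scale0r enorm0 ltW.
have m0 : 0 < fine (mu (P i)) by rewrite lt_neqAle eq_sym A0 fine_ge0.
have H := enorm_average_le (mP i) (Poo i) (@mtrunc i) (integrable_trunc i).
rewrite -(ler_pM2l m0) (le_trans H)//.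
rewrite mulrC -Rintegral_cst//; apply: le_Rintegral => //.
- exact: integrable_trunc.
- by apply: (@integrable_bounded _ _ _ _ _ _ `|gam|) => // s _.
- by move=> s _; exact: enorm_trunc_le_gam.
Qed.

Lemma sum_measure_average_le :
  (\sum_i mu (P i) * (enorm (a i) `^ p)%:E <= (r `^ p)%:E)%E.
Proof.
apply: le_trans xr.
rewrite (ge0_integral_partition mu mP disjP covP); last 2 first.
  exact/measurable_EFinP.
  by move=> s _; rewrite lee_fin powR_ge0.
apply: lee_sum => i _.
have H := powR_enorm_average_le (mP i) (Poo i) (@mtrunc i) (integrable_trunc i) p0 q0 pq.
apply: (le_trans H).
apply: le_integral_ge0 => [s _|s _]; first by rewrite lee_fin powR_ge0.
by rewrite lee_fin ge0_ler_powR ?nnegrE ?enorm_ge0 ?enorm_trunc_le ?(ltW p0).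
Qed.

Section test_field.
Variables (v : 'I_N -> 'cV[R]_n) (eta : R).
Hypothesis eta_ge : forall i, enorm (a i - v i) <= eta.
Variables (b : T -> 'cV[R]_n) (M om : R).
Hypotheses (M0 : 0 <= M) (om0 : 0 <= om) (mb : vmeasurable D b).
Hypothesis bM : forall s, D s -> enorm (b s) <= M.
Hypothesis bom : forall i s s', P i s -> P i s' -> enorm (b s - b s') <= om.
Variable y : T -> 'cV[R]_n.
Hypothesis yv : forall i s, P i s -> y s = v i.

Let alpha := M / gam `^ (p - 1).

Lemma dot_sub_step_le i s0 s : P i s0 -> P i s ->
  dot (b s) (x s - y s) <= alpha * enorm (x s) `^ p + om * enorm (trunc s) +
     dot (b s0) (trunc s - a i) + (om * enorm (a i) + M * eta).
Proof.
move=> Ps0 Ps; have Ds := PD Ps.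
have -> : dot (b s) (x s - y s) = dot (b s) (x s - trunc s) +
    dot (b s - b s0) (trunc s - a i) + dot (b s0) (trunc s - a i) +
    dot (b s) (a i - v i).
  rewrite (yv Ps) -[_ + _ + dot (b s0) _]addrA -dotDl subrK -!dotDr.
  by congr dot; rewrite !addrA !subrK.
have H1 : dot (b s) (x s - trunc s) <= alpha * enorm (x s) `^ p.
  apply: le_trans (ler_norm _) _; apply: le_trans (normr_dot_le _ _) _.
  rewrite /alpha -mulrA [_^-1 * _]mulrC.
  by apply: ler_pM; rewrite ?enorm_ge0 ?bM ?enorm_sub_trunc_le.
have H2 : dot (b s - b s0) (trunc s - a i) <= om * enorm (trunc s) + om * enorm (a i).
  apply: le_trans (ler_norm _) _; apply: le_trans (normr_dot_le _ _) _.
  rewrite -mulrDr; apply: ler_pM; rewrite ?enorm_ge0 ?enormB//.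
  exact: bom Ps Ps0.
have H3 : dot (b s) (a i - v i) <= M * eta.
  apply: le_trans (ler_norm _) _; apply: le_trans (normr_dot_le _ _) _.
  by apply: ler_pM; rewrite ?enorm_ge0 ?bM.
lra.
Qed.

Lemma integrable_dot_sub :
  mu.-integrable D (EFin \o (fun s => dot (b s) (x s - y s))).
Proof.
apply: (@integrable_dominated _ _ _ _ _ _
    (fun s => M * enorm (x s) + M * \sum_i enorm (v i))) => //.
- apply: measurable_dot => //; apply: vmeasurableB => //.
  exact: vmeasurable_step yv.
- move=> s Ds; apply: le_trans (normr_dot_le _ _) _.
  rewrite -mulrDr; apply: ler_pM; rewrite ?enorm_ge0 ?bM//.
  apply: le_trans (enormB _ _) _; rewrite lerD2l.
  have : (\bigcup_(i in [set: 'I_N]) P i) s by rewrite covP.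
  move=> [i _ Pis]; rewrite (yv Pis) (bigD1 i)//= lerDl.
  by apply: sumr_ge0 => j _; exact: enorm_ge0.
- have i1 := integrableZl mD M integrable_enorm.
  have i2 : mu.-integrable D (EFin \o (fun=> M * \sum_i enorm (v i))).
    by apply: (@integrable_bounded _ _ _ _ _ _ `|M * \sum_i enorm (v i)|).
  exact: (integrableD mD i1 i2).
Qed.

Lemma integral_cell_le i : \int[mu]_(s in P i) dot (b s) (x s - y s) <=
  alpha * \int[mu]_(s in P i) (enorm (x s) `^ p) +
  2 * om * \int[mu]_(s in P i) enorm (x s) + M * eta * fine (mu (P i)).
Proof.
have ida : mu.-integrable D (EFin \o (fun s => dot (b s) (x s - y s))).
  exact: integrable_dot_sub.
have ixp : mu.-integrable (P i) (EFin \o (fun s => enorm (x s) `^ p)).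
  by apply: integrableS integrable_powR_enorm => //; exact: PD.
have ix : mu.-integrable (P i) (EFin \o (fun s => enorm (x s))).
  by apply: integrableS integrable_enorm => //; exact: PD.
have itr := integrable_trunc i.
have ic (c : R) : mu.-integrable (P i) (EFin \o (fun=> c)).
  by apply: (@integrable_bounded _ _ _ _ _ _ `|c|).
(* An empty cell offers no base point [s0], but all its integrals vanish. *)
have [Pi0|/set0P[s0 Ps0]] := eqVneq (P i) set0.
  by rewrite Pi0 !Rintegral_set0 measure0/= !mulr0 !addr0.
have mta : vmeasurable (P i) (fun s => trunc s - a i).
  by apply: vmeasurableB; [exact: mtrunc|exact: vmeasurable_cst].
have ita : mu.-integrable (P i) (EFin \o (fun s => enorm (trunc s - a i))).
  apply: (@integrable_bounded _ _ _ _ _ _ (gam + gam)) => //.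
    exact: measurable_venorm.
  move=> s _; rewrite ger0_norm ?enorm_ge0// (le_trans (enormB _ _))// lerD//.
    exact: enorm_trunc_le_gam.
  exact: enorm_average_trunc_le.
have idot := integrable_dot (mP i) (b s0) mta ita.
(* The cancellation: with the test vector frozen at [s0], only the integral of [trunc - a i] over
   the cell matters, and it is 0 by the choice of [a i]. *)
have dot0 : \int[mu]_(s in P i) dot (b s0) (trunc s - a i) = 0.
  rewrite -dot_vint//.
  have -> : vint mu (P i) (fun s => trunc s - a i) = 0; last first.
    by rewrite /dot big1// => j _; rewrite mxE mulr0.
  have ica : mu.-integrable (P i) (EFin \o (fun=> enorm (a i))) by exact: ic.
  have mca : vmeasurable (P i) (fun=> a i) by exact: vmeasurable_cst.
  rewrite -(vintB (mP i) (@mtrunc i) mca itr ica) -(scale_average (mP i) (Poo i) (@mtrunc i)).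
  apply/eqP; rewrite subr_eq0; apply/eqP/matrixP => j k.
  by rewrite !mxE Rintegral_cst// [RHS]mulrC ord1.
(* With the next bound this explains the factor 2 before [om]: the average and the truncation each
   cost at most the integral of [|x|]. *)
have H : fine (mu (P i)) * enorm (a i) <= \int[mu]_(s in P i) enorm (x s).
  apply: le_trans (enorm_average_le (mP i) (Poo i) (@mtrunc i) itr) _.
  by apply: le_Rintegral => // s _; exact: enorm_trunc_le.
have H' : \int[mu]_(s in P i) enorm (trunc s) <= \int[mu]_(s in P i) enorm (x s).
  by apply: le_Rintegral => // s _; exact: enorm_trunc_le.
have iA : mu.-integrable (P i) (EFin \o (fun s => alpha * enorm (x s) `^ p)).
  exact: (integrableZl (mP i) alpha ixp).
have iB : mu.-integrable (P i) (EFin \o (fun s => om * enorm (trunc s))).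
  exact: (integrableZl (mP i) om itr).
have iAB := integrableD (mP i) iA iB.
have iABC := integrableD (mP i) iAB idot.
have iABCK := integrableD (mP i) iABC (ic (om * enorm (a i) + M * eta)).
apply: (@le_trans _ _ (\int[mu]_(s in P i) (alpha * enorm (x s) `^ p +
    om * enorm (trunc s) + dot (b s0) (trunc s - a i) +
    (om * enorm (a i) + M * eta)))).
  apply: le_Rintegral => //; last by move=> s; exact: dot_sub_step_le.
  by apply: integrableS ida => //; exact: PD.
rewrite RintegralD// RintegralD// RintegralD// RintegralZl// RintegralZl//.
rewrite dot0 Rintegral_cst// addr0.
have := ler_wpM2l om0 H; have := ler_wpM2l om0 H'.
by lra.
Qed.

Lemma integral_dot_sub_step_le :
  \int[mu]_(s in D) dot (b s) (x s - y s) <= M * r `^ p / gam `^ (p - 1) +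
    2 * om * (r * fine (mu D) `^ q^-1) + M * eta * fine (mu D).
Proof.
have ic : mu.-integrable D (EFin \o (fun=> 1 : R)).
  by apply: (@integrable_bounded _ _ _ _ _ _ 1) => // s _; rewrite normr1.
have mu1 (A : set T) : measurable A -> \int[mu]_(s in A) (1 : R) = fine (mu A).
  by move=> mA; rewrite Rintegral_cst// mul1r.
have parti := integral_partition mP disjP covP.
rewrite (parti R mu _ integrable_dot_sub).
apply: (@le_trans _ _ (\sum_i (alpha * \int[mu]_(s in P i) (enorm (x s) `^ p) +
  2 * om * \int[mu]_(s in P i) enorm (x s) + M * eta * fine (mu (P i))))).
  by apply: ler_sum => i _; exact: integral_cell_le.
rewrite !big_split /= -!mulr_sumr -(parti R mu _ integrable_powR_enorm).
rewrite -(parti R mu _ integrable_enorm).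
(* The measures of the cells are summed as integrals of the constant 1. *)
rewrite -(eq_bigr _ (fun i _ => mu1 _ (mP i))) -(parti R mu _ ic) mu1//.
rewrite lerD2r; apply: lerD.
  rewrite [leRHS]mulrAC; apply: ler_wpM2l; last exact: Rintegral_powR_enorm_le.
  by rewrite divr_ge0 ?powR_ge0.
by apply: ler_wpM2l; [rewrite mulr_ge0|exact: Rintegral_enorm_le].
Qed.

End test_field.
End function.
End step_approximation.

(** The norm of [u] is rounded down to the grid and its direction moved to the net. Rounding down is
    what preserves the constraint of the discrete ball. *)
Lemma net_rounding (R : realType) (n a c : nat) (e : 'I_c -> 'cV[R]_n)
    (gam sigma : R) (u : 'cV[R]_n) :
  (0 < n)%N -> (0 < a)%N -> 0 < gam -> 0 < sigma ->
  (forall x : 'cV[R]_n, enorm x = 1 -> exists l, enorm (x - e l) <= sigma) ->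
  enorm u <= gam ->
  exists (j : 'I_a.+1) (l : 'I_c), j%:R * (gam / a%:R) <= enorm u /\
    enorm (u - (j%:R * (gam / a%:R)) *: e l) <= gam / a%:R + gam * sigma.
Proof.
move=> n0 a0 gam0 sigma0 net ugam.
have d0 : 0 < gam / a%:R by rewrite divr_gt0// ltr0n.
(* Polar form; the zero vector receives a basis vector as its direction, which exists since
   [0 < n]. *)
have [w w1 uw] : exists2 w : 'cV[R]_n, enorm w = 1 & u = enorm u *: w.
  have [u0|u0] := eqVneq (enorm u) 0.
    exists (delta_mx (Ordinal n0) ord0); last first.
      by rewrite u0 scale0r; exact: enorm_eq0.
    apply/eqP; rewrite -(@eqrXn2 _ 2) ?enorm_ge0// sqr_enorm expr1n.
    rewrite (bigD1 (Ordinal n0))//= big_ord1 mxE !eqxx expr1n big1 ?addr0//.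
    by move=> i i0; rewrite big_ord1 mxE (negbTE i0) expr0n.
  exists ((enorm u)^-1 *: u); last by rewrite scalerA mulfV// scale1r.
  by rewrite enormZ ger0_norm ?invr_ge0 ?enorm_ge0// mulVf.
have [l wl] := net w w1.
pose N := Num.truncn (enorm u / (gam / a%:R)).
have ud : 0 <= enorm u / (gam / a%:R) by rewrite divr_ge0 ?enorm_ge0 ?ltW.
have /andP[Nle Nlt] := truncn_itv ud; rewrite -/N in Nle Nlt.
(* The rounded index is at most [a], because [enorm u <= gam] and [gam] is [a] steps. *)
have Na : (N < a.+1)%N.
  rewrite ltnS -(ler_nat R); apply: (le_trans Nle).
  by rewrite ler_pdivrMr// mulrCA divff ?mulr1// pnatr_eq0 -lt0n.
exists (Ordinal Na), l => /=.
rewrite ler_pdivlMr// in Nle; rewrite ltr_pdivrMr// -natr1 mulrDl mul1r in Nlt.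
split=> //; set z := N%:R * (gam / a%:R).
have z0 : 0 <= z by rewrite mulr_ge0// ltW.
(* The first term has norm below one step, the second at most [z * sigma], with
   [z <= enorm u <= gam]. *)
have -> : u - z *: e l = (enorm u - z) *: w + z *: (w - e l).
  by rewrite {1}uw scalerBl scalerBr addrA subrK.
apply: (le_trans (enormD _ _)); rewrite !enormZ w1 mulr1.
rewrite ger0_norm ?subr_ge0// ger0_norm//; apply: lerD.
  by rewrite lerBlDr addrC ltW.
by apply: ler_pM; rewrite ?enorm_ge0// (le_trans Nle).
Qed.

(** * Integral operators on step approximations *)

Section kernel_difference.
Context d (T : measurableType d) (R : realType) (mu : {measure set T -> \bar R}).
Variables (N : nat) (D : set T) (P : 'I_N -> set T).
Hypothesis mP : forall i, measurable (P i).
Hypothesis disjP : forall i j, i != j -> P i `&` P j = set0.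
Hypothesis covP : \bigcup_(i in [set: 'I_N]) P i = D.
Hypothesis Doo : (mu D < +oo)%E.
Variables (m n : nat) (p q r gam : R).
Hypotheses (p1 : 1 < p) (pq : p^-1 + q^-1 = 1) (r0 : 0 < r) (gam0 : 0 < gam).

Let p0 : 0 < p. Proof. by rewrite (lt_trans _ p1). Qed.

Let q0 : 0 < q.
Proof.
rewrite -invr_gt0; have -> : q^-1 = 1 - p^-1 by rewrite -pq addrC addKr.
by rewrite subr_gt0 invf_lt1.
Qed.

Let mD : measurable D.
Proof. by rewrite -covP; exact: fin_bigcup_measurable. Qed.

Lemma hoelder_le (f g : T -> R) (a b : R) : 0 <= a -> 0 <= b ->
  measurable_fun D f -> measurable_fun D g ->
  (forall s, D s -> 0 <= f s) -> (forall s, D s -> 0 <= g s) ->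
  (\int[mu]_(s in D) (f s `^ q)%:E <= a%:E)%E ->
  (\int[mu]_(s in D) (g s `^ p)%:E <= (b `^ p)%:E)%E ->
  mu.-integrable D (EFin \o (fun s => f s * g s)) /\
  \int[mu]_(s in D) (f s * g s) <= a `^ q^-1 * b.
Proof.
move=> a0 b0 mf mg f0 g0 fa gb.
have le : (\int[mu]_(s in D) (f s * g s)%:E <= (a `^ q^-1 * b)%:E)%E.
  have qp : q^-1 + p^-1 = 1 by rewrite addrC.
  apply: le_trans (hoelder_in mu mD mf mg f0 g0 q0 p0 qp) _.
  rewrite EFinM; apply: lee_pmul; rewrite ?poweR_ge0//.
    rewrite -poweR_EFin; apply: gt0_ler_poweR => //; first by rewrite invr_ge0 ltW.
      rewrite in_itv /= leey andbT; apply: integral_ge0 => s _.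
      by rewrite lee_fin powR_ge0.
    by rewrite in_itv /= leey andbT lee_fin.
  rewrite (_ : b%:E = (b `^ p)%:E `^ p^-1)%E; last first.
    by rewrite poweR_EFin -powRrM mulfV ?gt_eqF// powRr1.
  apply: gt0_ler_poweR => //; first by rewrite invr_ge0 ltW.
    rewrite in_itv /= leey andbT; apply: integral_ge0 => s _.
    by rewrite lee_fin powR_ge0.
  by rewrite in_itv /= leey andbT lee_fin powR_ge0.
have I : mu.-integrable D (EFin \o (fun s => f s * g s)).
  apply/integrableP; split; first by apply/measurable_EFinP; exact: measurable_funM.
  apply: le_lt_trans (ltry (a `^ q^-1 * b)); apply: le_trans le.
  by apply: le_integral_ge0 => [s Ds|s Ds];
    rewrite /= ?lee_fin ?normr_ge0// ger0_norm ?mulr_ge0 ?f0 ?g0.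
by split=> //; rewrite -lee_fin (fineK (integrable_fin_num mD I)).
Qed.

(** Minkowski's inequality, raised to the power [p]; the origin of the [2 * r] that cancels the
    denominator of [lam / (2 * r)]. *)
Lemma integral_powR_enormB_le (x y : T -> 'cV[R]_n) :
  vmeasurable D x -> vmeasurable D y ->
  (\int[mu]_(s in D) (enorm (x s) `^ p)%:E <= (r `^ p)%:E)%E ->
  (\int[mu]_(s in D) (enorm (y s) `^ p)%:E <= (r `^ p)%:E)%E ->
  (\int[mu]_(s in D) (enorm (x s - y s) `^ p)%:E <= ((2 * r) `^ p)%:E)%E.
Proof.
move=> mx my xr yr.
have root (z : T -> 'cV[R]_n) :
    (\int[mu]_(s in D) (enorm (z s) `^ p)%:E <= (r `^ p)%:E)%E ->
    ((\int[mu]_(s in D) (enorm (z s) `^ p)%:E) `^ p^-1 <= r%:E)%E.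
  move=> zr; rewrite (_ : r%:E = (r `^ p)%:E `^ p^-1)%E; last first.
    by rewrite poweR_EFin -powRrM mulfV ?gt_eqF// powRr1// ltW.
  apply: gt0_ler_poweR => //; first by rewrite invr_ge0 ltW.
    rewrite in_itv /= leey andbT; apply: integral_ge0 => s _.
    by rewrite lee_fin powR_ge0.
  by rewrite in_itv /= leey andbT lee_fin powR_ge0.
have := minkowski_in mu mD (measurable_venorm mx) (measurable_venorm my)
  (fun s _ => enorm_ge0 _) (fun s _ => enorm_ge0 _) (ltW p1).
move=> /le_trans/(_ (leeD (root x xr) (root y yr))); rewrite -EFinD -mulr2n -[r *+ 2]mulr_natl.
set J := (\int[mu]_(s in D) _)%E => JR.
have J0 : (0 <= J)%E by apply: integral_ge0 => s _; rewrite lee_fin powR_ge0.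
apply: (@le_trans _ _ J).
  apply: le_integral_ge0 => s _; first by rewrite lee_fin powR_ge0.
  by rewrite lee_fin ge0_ler_powR ?nnegrE ?addr_ge0 ?enorm_ge0 ?enormB ?(ltW p0).
have -> : (J = (J `^ p^-1) `^ p)%E.
  by rewrite -poweRrM mulVf ?gt_eqF// poweRe1.
rewrite -poweR_EFin; apply: gt0_ler_poweR => //; first exact: ltW.
  by rewrite in_itv /= leey andbT poweR_ge0.
by rewrite in_itv /= leey andbT lee_fin mulr_ge0// ltW.
Qed.

Variables (x y : T -> 'cV[R]_n) (v : 'I_N -> 'cV[R]_n) (eta : R).
Hypothesis mx : vmeasurable D x.
Hypothesis xr : (\int[mu]_(s in D) (enorm (x s) `^ p)%:E <= (r `^ p)%:E)%E.
Hypothesis eta0 : 0 <= eta.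
Hypothesis eta_ge : forall i,
  enorm (average mu (P i) (trunc gam x) - v i) <= eta.
Hypothesis yv : forall i s, P i s -> y s = v i.
Hypothesis yr : (\int[mu]_(s in D) (enorm (y s) `^ p)%:E <= (r `^ p)%:E)%E.

Variables (A F B : T -> 'M[R]_(m, n)) (g M om : R).
Hypothesis AFB : forall s, D s -> A s = F s + B s.
Hypothesis mF : forall i j, measurable_fun D (fun s => F s i j).
Hypothesis mB : forall i j, measurable_fun D (fun s => B s i j).
Hypotheses (g0 : 0 <= g) (M0 : 0 <= M) (om0 : 0 <= om).
Hypothesis Fg : (\int[mu]_(s in D) (enorm (F s) `^ q)%:E <= g%:E)%E.
Hypothesis BM : forall s, D s -> enorm (B s) <= M.
Hypothesis Bom : forall i s s', P i s -> P i s' -> enorm (B s - B s') <= om.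

Let my : vmeasurable D y.
Proof. exact: (vmeasurable_step mP covP yv). Qed.

Let mA i j : measurable_fun D (fun s => A s i j).
Proof.
apply: (eq_measurable_fun (fun s => F s i j + B s i j)).
  by move=> s /set_mem Ds; rewrite AFB// mxE.
exact: measurable_funD.
Qed.

Let iA (w : T -> 'cV[R]_n) : vmeasurable D w ->
  (\int[mu]_(s in D) (enorm (w s) `^ p)%:E <= (r `^ p)%:E)%E ->
  mu.-integrable D (EFin \o (fun s => enorm (A s *m w s))).
Proof.
move=> mw wr.
have [i1 _] := hoelder_le g0 (ltW r0) (measurable_enorm mF)
  (measurable_venorm mw) (fun s _ => enorm_ge0 _) (fun s _ => enorm_ge0 _) Fg wr.
have i2 := integrableZl mD M (integrable_enorm mP covP Doo p1 pq r0 mw wr).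
apply: (integrable_dominated (g := fun s => enorm (F s) * enorm (w s) +
   M * enorm (w s))) => //.
- by apply: measurable_venorm; exact: vmeasurable_mulmx.
- move=> s Ds; rewrite ger0_norm ?enorm_ge0// (le_trans (enorm_mulmx _ _))//.
  rewrite -mulrDl; apply: ler_wpM2r; rewrite ?enorm_ge0// AFB//.
  by rewrite (le_trans (enormD _ _))// lerD2l BM.
- exact: (integrableD mD i1 i2).
Qed.

(** For a fixed [xi], [A] is the section of [K], [B] that of [Kl], and [F] their difference. Testing
    bounds [|u|^2] by [|u|] times the right side, and [|u|] is cancelled. *)
Lemma enorm_vint_sub_le : enorm (vint mu D (fun s => A s *m x s) -
    vint mu D (fun s => A s *m y s)) <=
  2 * r * g `^ q^-1 + (M * r `^ p / gam `^ (p - 1) +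
    2 * om * (r * fine (mu D) `^ q^-1) + M * eta * fine (mu D)).
Proof.
have mAx := vmeasurable_mulmx mA mx; have mAy := vmeasurable_mulmx mA my.
rewrite (vintB mD mAx mAy (iA mx xr) (iA my yr)).
set C := (X in _ <= _ + X); pose w s := x s - y s.
have mw : vmeasurable D w by exact: vmeasurableB.
have wr := integral_powR_enormB_le mx my xr yr.
have Ew s : A s *m x s - A s *m y s = A s *m w s by rewrite mulmxBr.
under eq_fun do rewrite Ew.
set u := vint mu D _.
have C0 : 0 <= C.
  by rewrite !addr_ge0// ?divr_ge0// ?mulr_ge0 ?powR_ge0 ?fine_ge0// ltW.
have [u0|u0] := eqVneq (enorm u) 0.
  by rewrite u0 addr_ge0// !mulr_ge0 ?powR_ge0// ltW.
have {}u0 : 0 < enorm u by rewrite lt_neqAle eq_sym u0 enorm_ge0.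
have mAw := vmeasurable_mulmx mA mw.
have iAw : mu.-integrable D (EFin \o (fun s => enorm (A s *m w s))).
  apply: (integrable_dominated (g := fun s => enorm (A s *m x s) + enorm (A s *m y s))) => //.
  - exact: measurable_venorm.
  - by move=> s _; rewrite ger0_norm ?enorm_ge0// -Ew enormB.
  - exact: (integrableD mD (iA mx xr) (iA my yr)).
have r20 : 0 <= 2 * r by rewrite mulr_ge0// ltW.
have [iFw Fw] := hoelder_le g0 r20 (measurable_enorm mF)
  (measurable_venorm mw) (fun s _ => enorm_ge0 _) (fun s _ => enorm_ge0 _) Fg wr.
(* Transposing moves [B] onto the test vector; the field [b] inherits the bound and the oscillation
   of [B], both scaled by [|u|]. *)
pose b s := (B s)^T *m u.
have mb : vmeasurable D b.
  apply: vmeasurable_mulmx; last exact: vmeasurable_cst.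
  by move=> i j; under eq_fun do rewrite mxE; exact: mB.
have bM s : D s -> enorm (b s) <= M * enorm u.
  move=> Ds; apply: (le_trans (enorm_mulmx _ _)).
  by rewrite enorm_tr ler_wpM2r ?enorm_ge0 ?BM.
have bom i s s' : P i s -> P i s' -> enorm (b s - b s') <= om * enorm u.
  move=> Ps Ps'; rewrite /b -mulmxBl -linearB /=.
  apply: (le_trans (enorm_mulmx _ _)).
  by rewrite enorm_tr ler_wpM2r ?enorm_ge0// (Bom Ps Ps').
have Mu0 : 0 <= M * enorm u by rewrite mulr_ge0// ltW.
have omu0 : 0 <= om * enorm u by rewrite mulr_ge0// ltW.
have S := integral_dot_sub_step_le mP disjP covP Doo p1 pq r0 gam0 mx xr eta_ge
  Mu0 omu0 mb bM bom yv.
have iS := integrable_dot_sub mP covP Doo p1 pq r0 mx xr mb bM yv.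
have iF := integrableZl mD (enorm u) iFw.
rewrite -(ler_pM2l u0) -expr2 -dotvv {2}/u dot_vint//.
apply: (@le_trans _ _ (\int[mu]_(s in D) (enorm u * (enorm (F s) * enorm (w s)) +
   dot (b s) (w s)))).
  apply: le_Rintegral => //.
  - exact: integrable_dot.
  - exact: (integrableD mD iF iS).
  - move=> s Ds; rewrite AFB// mulmxDl dotDr -[dot (b s) _]dot_mulmx lerD2r.
    apply: le_trans (ler_norm _) _; apply: le_trans (normr_dot_le _ _) _.
    by rewrite ler_wpM2l ?enorm_ge0// enorm_mulmx.
rewrite RintegralD// RintegralZl// mulrDr; apply: lerD.
  by rewrite ler_wpM2l ?enorm_ge0// (le_trans Fw)// mulrC.
apply: (le_trans S); rewrite /C.
rewrite le_eqVlt; apply/orP; left; apply/eqP; ring.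
Qed.

End kernel_difference.

(** * Almost every section of the kernel, and the exchange of the integrals *)

Section kernel_sections.
Context d (T : measurableType d) (R : realType).
Variable mu : {sigma_finite_measure set T -> \bar R}.
Local Open Scope ereal_scope.

Lemma null_of_integral0 (f : T -> \bar R) : measurable_fun setT f ->
  (forall x, 0 <= f x) -> \int[mu]_x f x = 0 ->
  exists N, [/\ measurable N, mu N = 0 & forall x, ~ N x -> f x = 0].
Proof.
move=> mf f0 If.
have : \int[mu]_x `|f x| = 0.
  by rewrite -[RHS]If; apply: eq_integral => x _; rewrite gee0_abs.
move/(ae_eq_integral_abs mu measurableT mf) => [N [mN N0 HN]].
exists N; split => // x nNx; apply: contrapT => fx0; apply: nNx; apply: HN => /=.
by move=> /(_ I).
Qed.

(** The product measure is by definition the integral of the measures of the [x]-sections, and by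
    Tonelli also that of the [y]-sections; a nonnegative function of integral 0 vanishes off a null
    set. *)
Lemma null_sections (P : set (T * T)) : measurable P -> (mu \x mu) P = 0 ->
  exists N, [/\ measurable N, mu N = 0 &
    forall x, ~ N x -> mu (xsection P x) = 0 /\ mu (ysection P x) = 0].
Proof.
move=> mP P0.
have [N1 [mN1 N10 H1]] := @null_of_integral0 (mu \o xsection P)
  (measurable_fun_xsection mu mP) (fun x => measure_ge0 _ _) P0.
have P0' : \int[mu]_x (mu \o ysection P) x = 0.
  have := @indic_fubini_tonelli _ _ T T R mu mu P mP.
  by rewrite indic_fubini_tonelli_FE// indic_fubini_tonelli_GE// => <-.
have [N2 [mN2 N20 H2]] := @null_of_integral0 (mu \o ysection P)
  (measurable_fun_ysection mu mP) (fun x => measure_ge0 _ _) P0'.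
exists (N1 `|` N2); split.
- exact: measurableU.
- by rewrite measureU0.
- by move=> x /not_orP[n1 n2]; split; [exact: H1|exact: H2].
Qed.

(** [G xi] integrates the [q]-th power of the norm of the product-measurable version [F'], to which
    Tonelli applies. For [xi] outside [N] the section of [F] agrees almost everywhere with that of
    [F']: completeness makes it measurable, and its integral is at most [G xi]. *)
Lemma kernel_sections (m n : nat) (D : set T) (P : set (T * T)) (q : R)
    (F : T -> T -> 'M[R]_(m, n)) (F' : 'I_m -> 'I_n -> T * T -> R) (L : \bar R) :
  measure_is_complete mu -> measurable D ->
  (forall i j, measurable_fun setT (F' i j)) ->
  measurable P -> (mu \x mu) P = 0 ->
  (forall t, ~ P t -> D t.1 -> D t.2 -> forall i j, F t.1 t.2 i j = F' i j t) ->
  \int[mu]_(s in D) \int[mu]_(xi in D) (enorm (F xi s) `^ q)%:E <= L ->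
  exists (G : T -> \bar R) (N : set T),
    [/\ measurable_fun setT G, (forall xi, 0 <= G xi), \int[mu]_(xi in D) G xi <= L,
        measurable N & mu N = 0 /\
        forall xi, D xi -> ~ N xi ->
          (forall i j, measurable_fun D (fun s => F xi s i j)) /\
          \int[mu]_(s in D) (enorm (F xi s) `^ q)%:E <= G xi].
Proof.
move=> cmu mD mF' mP P0 FF' FL.
have [N [mN N0 HN]] := null_sections mP P0.
pose F2 t : 'M[R]_(m, n) := \matrix_(i, j) F' i j t.
pose h (t : T * T) := (enorm (F2 t) `^ q)%:E.
pose hD := h \_ (D `*` D).
have mh : measurable_fun setT h.
  apply/measurable_EFinP.
  apply: (measurableT_comp (measurable_powR q)); apply: measurable_enorm => i j.
  by under eq_fun do rewrite mxE; exact: mF'.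
have mhD : measurable_fun setT hD.
  apply/(measurable_restrictT _ (measurableX mD mD)).
  exact: measurable_funS mh.
have h0 t : 0 <= h t by rewrite lee_fin powR_ge0.
have hD0 t : 0 <= hD t by rewrite /hD patchE; case: ifPn.
have hE t : ~ P t -> D t.1 -> D t.2 -> h t = (enorm (F t.1 t.2) `^ q)%:E.
  move=> nP D1 D2; congr (_ `^ _)%:E; congr enorm; apply/matrixP => i j.
  by rewrite mxE FF'.
pose G x := \int[mu]_y hD (x, y).
exists G, N; split => //.
- exact: measurable_fun_fubini_tonelli_F.
- by move=> xi; apply: integral_ge0.
- apply: le_trans FL.
  apply: (@le_trans _ _ (\int[mu]_x G x)).
    rewrite integral_mkcond; apply: le_integral_ge0 => x _.
      by rewrite patchE; case: ifPn => // _; exact: integral_ge0.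
    by rewrite patchE; case: ifPn => // _; exact: integral_ge0.
  have -> : \int[mu]_x G x = \int[mu]_y \int[mu]_x hD (x, y).
    exact: (@fubini_tonelli _ _ T T R mu mu hD mhD hD0).
  rewrite [leRHS]integral_mkcond.
  (* Back from [F'] to [F] in the order of the hypothesis: the outer comparison ignores [N], and for
     each remaining [s] the inner one ignores the null [y]-section of [P]. *)
  apply: (@le_integral_ae _ _ _ mu setT N) => // [s _|s _|s _ nNs].
  - exact: integral_ge0.
  - rewrite patchE; case: ifPn => // _; apply: integral_ge0 => x _.
    by rewrite lee_fin powR_ge0.
  rewrite patchE; case: ifPn => [/set_mem Ds|/negP nDs]; last first.
    rewrite integral0_eq// => x _; rewrite /hD patchE ifN//.
    by apply/negP => /set_mem[_ /= Ds]; apply: nDs; exact/mem_set.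
  have [_ Ps0] := HN s nNs.
  rewrite [leRHS]integral_mkcond.
  apply: (@le_integral_ae _ _ _ mu setT (ysection P s)) => // [|x _|x _ nPx].
  - exact: measurable_ysection.
  - by rewrite patchE; case: ifPn => // _; rewrite lee_fin powR_ge0.
  rewrite /hD !patchE; case: ifPn => [/set_mem[/= Dx _]|_].
    rewrite ifT ?inE// hE//= => Pxs; apply: nPx.
    by rewrite /ysection /= inE.
  by case: ifPn => // _; rewrite lee_fin powR_ge0.
split=> // xi Dxi nNxi; have [Px0 _] := HN xi nNxi.
have mPx : measurable (xsection P xi) by exact: measurable_xsection.
have nPx s : ~ xsection P xi s -> ~ P (xi, s).
  by move=> h1 h2; apply: h1; rewrite /xsection /= inE.
split=> [i j|].
  apply: (@measurable_fun_ae_eq _ _ _ mu D (xsection P xi) _ (fun s => F' i j (xi, s))).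
  - exact: cmu.
  - exact/negligibleP.
  - have mc : measurable_fun setT (fun s => F' i j (xi, s)).
      exact: measurableT_comp (mF' i j) (pair1_measurable xi).
    exact: measurable_funS mc.
  - by move=> s Ds /nPx nP; rewrite -(FF' (xi, s)).
rewrite [leLHS]integral_mkcond.
apply: (@le_integral_ae _ _ _ mu setT (xsection P xi)) => // [s _|s _ nPs].
  by rewrite patchE; case: ifPn => // _; rewrite lee_fin powR_ge0.
rewrite /hD !patchE; case: ifPn => [/set_mem Ds|_].
  by rewrite ifT ?inE// hE//=; exact: nPx.
by case: ifPn.
Qed.

End kernel_sections.

(** * From pointwise bounds to [L_q] bounds; step functions *)

Section Lq_bound.
Context d (T : measurableType d) (R : realType) (mu : {measure set T -> \bar R}).
Local Open Scope ereal_scope.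

(** [f] may fail to be measurable, so it is first replaced by its almost-everywhere majorant
    [kap * G^(1/q) + C]; Minkowski then separates the two terms. *)
Lemma Lq_norm_le (D N : set T) (f : T -> R) (G : T -> \bar R) (q l kap C : R) :
  measurable D -> mu D < +oo -> (1 <= q)%R -> (0 <= l)%R -> (0 <= kap)%R -> (0 <= C)%R ->
  measurable N -> mu N = 0 -> (forall x, D x -> 0 <= f x)%R ->
  measurable_fun setT G -> (forall x, 0 <= G x) ->
  \int[mu]_(x in D) G x <= (l `^ q)%:E ->
  (forall x, D x -> ~ N x -> (G x < +oo)%E -> f x <= kap * fine (G x) `^ q^-1 + C)%R ->
  (\int[mu]_(x in D) (f x `^ q)%:E) `^ q^-1 <=
    (kap * l + C * fine (mu D) `^ q^-1)%:E.
Proof.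
move=> mD Doo q1 l0 kap0 C0 mN N0 f0 mG G0 GL fG.
have q0 : (0 < q)%R by exact: lt_le_trans q1.
have qi0 : (0 <= q^-1)%R by rewrite invr_ge0 ltW.
have mGD : measurable_fun D G by exact: measurable_funS mG.
have iG : mu.-integrable D G.
  apply/integrableP; split=> //; apply: le_lt_trans (ltry (l `^ q)).
  by rewrite (eq_integral G)// => x _; rewrite gee0_abs.
(* [N2] contains the points of [D] where [G] is infinite: there [fine] returns 0 and the majorant
   says nothing. *)
have [N2 [mN2 N20 HN2]] := integrable_ae mD iG.
pose g x := (kap * fine (G x) `^ q^-1)%R.
have mg : measurable_fun D g.
  apply: measurable_funM => //.
  apply: (measurableT_comp (measurable_powR q^-1)).
  exact: (measurableT_comp (fine_measurable measurableT)).
have g0 x : (0 <= g x)%R by rewrite mulr_ge0// powR_ge0.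
have fgC : \int[mu]_(x in D) (f x `^ q)%:E <= \int[mu]_(x in D) ((g x + C) `^ q)%:E.
  apply: (@le_integral_ae _ _ _ mu D (N `|` N2)).
  - exact: measurableU.
  - by rewrite measureU0.
  - by move=> x _; rewrite lee_fin powR_ge0.
  - by move=> x _; rewrite lee_fin powR_ge0.
  move=> x Dx /not_orP[nN nN2].
  have Gfin : G x \is a fin_num by apply: contrapT => nG; apply: nN2; apply: HN2 => /(_ Dx).
  rewrite lee_fin ge0_ler_powR ?nnegrE ?f0 ?(ltW q0)// ?addr_ge0//.
  by apply: fG => //; rewrite -ge0_fin_numE.
have mono (a b : \bar R) : 0 <= a -> a <= b -> a `^ q^-1 <= b `^ q^-1.
  move=> a0 ab; apply: gt0_ler_poweR => //; rewrite in_itv /= leey andbT//.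
  exact: le_trans ab.
apply: (le_trans (mono _ _ _ fgC)).
  by apply: integral_ge0 => x _; rewrite lee_fin powR_ge0.
apply: (le_trans (minkowski_in mu mD mg (measurable_cst C)
  (fun x _ => g0 x) (fun _ _ => C0) q1)).
rewrite EFinD; apply: leeD.
  have -> : (kap * l)%:E = ((kap * l) `^ q)%:E `^ q^-1.
    by rewrite poweR_EFin -powRrM mulfV ?gt_eqF// powRr1// mulr_ge0.
  apply: mono; first by apply: integral_ge0 => x _; rewrite lee_fin powR_ge0.
  rewrite (eq_integral (fun x => (kap `^ q)%:E * (fine (G x))%:E)); last first.
    move=> x _; rewrite -EFinM /g powRM ?powR_ge0// -powRrM mulVf ?gt_eqF//.
    by rewrite powRr1// fine_ge0.
  have mfG : measurable_fun D (EFin \o (fun x => fine (G x))).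
    apply/measurable_EFinP.
    exact: (measurableT_comp (fine_measurable measurableT)).
  rewrite (ge0_integralZl_EFin mu mD _ mfG); last 2 first.
  - by move=> x _; rewrite lee_fin fine_ge0.
  - exact: powR_ge0.
  rewrite powRM// EFinM; apply: lee_wpmul2l; first by rewrite lee_fin powR_ge0.
  apply: le_trans GL; apply: le_integral_ge0 => x _; first by rewrite lee_fin fine_ge0.
  have [Gfin|] := boolP (G x \is a fin_num); first by rewrite /= fineK.
  by rewrite ge0_fin_numE// -leNgt leye_eq => /eqP ->; rewrite leey.
have -> : (C * fine (mu D) `^ q^-1)%:E = (C `^ q * fine (mu D))%:E `^ q^-1.
  rewrite poweR_EFin powRM ?powR_ge0 ?fine_ge0// -powRrM mulfV ?gt_eqF//.
  by rewrite powRr1.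
rewrite (integral_cst mu mD (C `^ q)%:E) EFinM fineK// ge0_fin_numE//.
Qed.

Section step.
Variables (N : nat) (D : set T) (P : 'I_N -> set T).
Hypothesis mP : forall i, measurable (P i).
Hypothesis disjP : forall i j, i != j -> P i `&` P j = set0.
Hypothesis covP : \bigcup_(i in [set: 'I_N]) P i = D.
Variables (n : nat) (v : 'I_N -> 'cV[R]_n).

Lemma step_exists : exists y : T -> 'cV[R]_n, forall i s, P i s -> y s = v i.
Proof.
exists (fun s => (\sum_(i < N) (\1_(P i) s : R) *: v i)%R) => i s Pis.
rewrite (bigD1 i)//= indicE mem_set// scale1r big1 ?addr0// => j ji.
rewrite indicE memNset ?scale0r// => Pjs.
by have : set0 s by rewrite -(disjP ji); split.
Qed.

(** Turns the sum constraint of the discrete ball into the [L_p] constraint of [Bp]. *)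
Lemma integral_powR_step (y : T -> 'cV[R]_n) (p : R) :
  (forall i s, P i s -> y s = v i) ->
  \int[mu]_(s in D) (enorm (y s) `^ p)%:E =
  \sum_i mu (P i) * (enorm (v i) `^ p)%:E.
Proof.
move=> yv; rewrite (ge0_integral_partition mu mP disjP covP); last 2 first.
- apply/measurable_EFinP; apply: (measurableT_comp (measurable_powR p)).
  by apply: measurable_venorm; exact: (vmeasurable_step mP covP yv).
- by move=> s _; rewrite lee_fin powR_ge0.
apply: eq_bigr => i _.
rewrite (eq_integral (fun=> (enorm (v i) `^ p)%:E)); last first.
  by move=> s /set_mem Ps; rewrite (yv _ _ Ps).
by rewrite (integral_cst mu (mP i) (enorm (v i) `^ p)%:E) muleC.
Qed.

End step.
End Lq_bound.

(** * Distance from an image to the image of its rounded step function *)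

Section step_distance.
Context d (T : measurableType d) (R : realType).
Variable mu : {sigma_finite_measure set T -> \bar R}.
Hypothesis cmu : measure_is_complete mu.
Variables (N : nat) (D : set T) (P : 'I_N -> set T).
Hypothesis mP : forall i, measurable (P i).
Hypothesis disjP : forall i j, i != j -> P i `&` P j = set0.
Hypothesis covP : \bigcup_(i in [set: 'I_N]) P i = D.
Hypothesis Doo : (mu D < +oo)%E.
Variables (m n a c : nat) (p q r gam sigma lam M om : R) (e : 'I_c -> 'cV[R]_n).
Hypotheses (p1 : 1 < p) (pq : p^-1 + q^-1 = 1) (r0 : 0 < r) (gam0 : 0 < gam).
Hypotheses (sigma0 : 0 < sigma) (lam0 : 0 < lam) (M0 : 0 <= M) (om0 : 0 <= om).
Hypotheses (n0 : (0 < n)%N) (a0 : (0 < a)%N).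
Hypothesis e1 : forall l, enorm (e l) = 1.
Hypothesis net : forall x : 'cV[R]_n, enorm x = 1 -> exists l, enorm (x - e l) <= sigma.
Variables K Kl : T -> T -> 'M[R]_(m, n).
Variables (F' : 'I_m -> 'I_n -> T * T -> R) (Q : set (T * T)).
Hypothesis mF' : forall i j, measurable_fun setT (F' i j).
Hypothesis mQ : measurable Q.
Hypothesis Q0 : (mu \x mu)%E Q = 0%E.
Hypothesis FF' : forall t, ~ Q t -> D t.1 -> D t.2 ->
  forall i j, (K t.1 t.2 - Kl t.1 t.2) i j = F' i j t.
Hypothesis KKl : (\int[mu]_(s in D) \int[mu]_(xi in D)
  (enorm (K xi s - Kl xi s) `^ q)%:E <= ((lam / (2 * r)) `^ q)%:E)%E.
Hypothesis mKl : forall xi, D xi -> forall i j, measurable_fun D (fun s => Kl xi s i j).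
Hypothesis KlM : forall xi s, D xi -> D s -> enorm (Kl xi s) <= M.
Hypothesis Klom : forall xi i s s', D xi -> P i s -> P i s' ->
  enorm (Kl xi s - Kl xi s') <= om.

Local Notation z j := (j%:R * (gam / a%:R)).

Lemma step_distance (x : T -> 'cV[R]_n) : vmeasurable D x ->
  (\int[mu]_(s in D) (enorm (x s) `^ p)%:E <= (r `^ p)%:E)%E ->
  exists (jj : 'I_N -> 'I_a.+1) (ll : 'I_N -> 'I_c),
    (\sum_i mu (P i) * (z (jj i) `^ p)%:E <= (r `^ p)%:E)%E /\
    forall y, (forall i s, P i s -> y s = z (jj i) *: e (ll i)) ->
    ((\int[mu]_(xi in D) (enorm (vint mu D (fun s => K xi s *m x s) -
         vint mu D (fun s => K xi s *m y s)) `^ q)%:E) `^ q^-1 <=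
      (lam + (M * r `^ p / gam `^ (p - 1) + 2 * om * (r * fine (mu D) `^ q^-1) +
        M * (gam / a%:R + gam * sigma) * fine (mu D)) * fine (mu D) `^ q^-1)%:E)%E.
Proof.
move=> mx xr.
have p0 : 0 < p by rewrite (lt_trans _ p1).
have qi : q^-1 = 1 - p^-1 by rewrite -pq addrC addKr.
have q0 : 0 < q by rewrite -invr_gt0 qi subr_gt0 invf_lt1.
have q1 : 1 <= q by rewrite -invf_le1// qi gerBl invr_ge0 ltW.
have mD : measurable D by rewrite -covP; exact: fin_bigcup_measurable.
have z0 j : 0 <= z j :> R by rewrite mulr_ge0// divr_ge0// ltW.
pose av i := average mu (P i) (trunc gam x).
have /choice[jj /choice[ll H]] i : exists (j : 'I_a.+1) (l : 'I_c),
    z j <= enorm (av i) /\ enorm (av i - z j *: e l) <= gam / a%:R + gam * sigma.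
  apply: net_rounding => //.
  exact: (enorm_average_trunc_le mP covP Doo gam0 mx).
have zpr : (\sum_i mu (P i) * (z (jj i) `^ p)%:E <= (r `^ p)%:E)%E.
  apply: le_trans (sum_measure_average_le mP disjP covP Doo p1 pq gam0 mx xr).
  apply: lee_sum => i _; apply: lee_wpmul2l; first exact: measure_ge0.
  rewrite lee_fin ge0_ler_powR ?nnegrE ?enorm_ge0 ?(ltW p0)//.
  by case: (H i).
exists jj, ll; split => // y yv.
have yr : (\int[mu]_(s in D) (enorm (y s) `^ p)%:E <= (r `^ p)%:E)%E.
  rewrite (integral_powR_step mu mP disjP covP p yv).
  by under eq_bigr do rewrite enormZ e1 mulr1 ger0_norm//.
have eta0 : 0 <= gam / a%:R + gam * sigma.
  by rewrite addr_ge0 ?divr_ge0 ?mulr_ge0// ltW.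
have [G [NN [mG G0 GL mNN [NN0 HNN]]]] := kernel_sections cmu mD mF' mQ Q0 FF' KKl.
have r20 : 0 <= 2 * r by rewrite mulr_ge0// ltW.
set C := M * r `^ p / _ + _ + _.
have C0 : 0 <= C.
  by rewrite !addr_ge0// ?divr_ge0// ?mulr_ge0 ?powR_ge0 ?fine_ge0// ltW.
(* Exhibits [lam] as [kap * l], with [kap = 2 * r] from the pointwise estimate and [l] the [L_q]
   error of the kernel. *)
have -> : lam = 2 * r * (lam / (2 * r)) by rewrite mulrC divfK// gt_eqF// mulr_gt0.
apply: (Lq_norm_le (N := NN) (G := G)) => //.
- by rewrite divr_ge0// ltW.
- by move=> xi _; exact: enorm_ge0.
move=> xi Dxi nN Goo; have [mF FG] := HNN xi Dxi nN.
apply: (@enorm_vint_sub_le _ _ _ mu N D P mP disjP covP Doo m n p q r gam p1 pq r0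
   gam0 x y (fun i => z (jj i) *: e (ll i)) _ mx xr eta0 _ yv yr
   (K xi) (fun s => K xi s - Kl xi s) (Kl xi)) => //.
- by move=> i; case: (H i).
- by move=> s _; rewrite subrK.
- exact: mKl.
- by rewrite fine_ge0.
- by rewrite fineK// ge0_fin_numE.
- by move=> s; exact: KlM.
- by move=> i s s'; exact: Klom.
Qed.

End step_distance.

(** * Kernels on R^k *)

Section Rk_kernel.
Context (R : realType) (k m n : nat) (Om : set 'rV[R]_k).
Hypothesis cOm : compact Om.
Local Notation sq := ((@halves R k) @^-1` (Om `*` Om) : set (Rk R (k + k))).

(** Each matrix entry is approximated separately; coding the finitely many index pairs by integers
    makes the union of the exceptional sets a countable one. *)
Lemma kernel_product_approx (F : Rk R k -> Rk R k -> 'M[R]_(m, n)) :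
  (forall i j, measurable_fun sq
     (fun z : Rk R (k + k) => F (halves z).1 (halves z).2 i j)) ->
  exists (F' : 'I_m -> 'I_n -> Rk R k * Rk R k -> R) (Q : set (Rk R k * Rk R k)),
    [/\ forall i j, measurable_fun setT (F' i j), measurable Q,
      (leb R k \x leb R k)%E Q = 0%E &
      forall t, ~ Q t -> Om t.1 -> Om t.2 -> forall i j, F t.1 t.2 i j = F' i j t].
Proof.
move=> mF.
have /choice[F' /choice[Q H]] (ij : 'I_m * 'I_n) :
    exists (f' : Rk R k * Rk R k -> R) (P : set (Rk R k * Rk R k)),
      [/\ measurable_fun setT f', measurable P, (leb R k \x leb R k)%E P = 0%E &
        forall t, ~ P t -> sq (join_halves t) ->
          F (halves (join_halves t)).1 (halves (join_halves t)).2 ij.1 ij.2 = f' t].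
  exact: measurable_fun_approx (measurable_square cOm) (square_lty cOm) (mF ij.1 ij.2).
have halvesK (t : Rk R k * Rk R k) : halves (join_halves t) = t.
  by case: t => s t; rewrite /halves /join_halves row_mxKl row_mxKr.
pose Qn l := if unpickle l is Some ij then Q ij else set0.
have mQn l : measurable (Qn l).
  by rewrite /Qn; case: unpickle => // ij; case: (H ij).
exists (fun i j => F' (i, j)), (\bigcup_l Qn l); split.
- by move=> i j; case: (H (i, j)).
- exact: bigcupT_measurable.
- apply/negligibleP; first exact: bigcupT_measurable.
  apply: negligible_bigcup => l; rewrite /Qn; case: unpickle => [ij|].
    by case: (H ij) => _ mQ Q0 _; apply/negligibleP.
  exact: negligible_set0.
move=> t nQ O1 O2 i j; case: (H (i, j)) => _ _ _ /(_ t).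
have -> : sq (join_halves t) = (Om `*` Om) t := f_equal (Om `*` Om) (halvesK t).
rewrite halvesK; apply; last by split.
move=> Qt; apply: nQ; exists (pickle (i, j)); first by [].
by rewrite /Qn pickleK.
Qed.

Variable Kl : Rk R k -> Rk R k -> 'M[R]_(m, n).
Hypothesis cKl : {within [set t : 'rV[R]_k * 'rV[R]_k | Om t.1 /\ Om t.2],
     continuous (fun t : 'rV[R]_k * 'rV[R]_k => Kl t.1 t.2)}.

Lemma within_continuous_entry i j :
  {within Om `*` Om, continuous (fun t : 'rV[R]_k * 'rV[R]_k => Kl t.1 t.2 i j)}.
Proof.
move=> t; apply: (@continuous_comp (subspace (Om `*` Om)) _ _
  (fun t : 'rV[R]_k * 'rV[R]_k => Kl t.1 t.2) (fun A : 'M[R]_(m, n) => A i j)).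
  exact: cKl.
exact: coord_continuous.
Qed.

Lemma measurable_kernel_square i j :
  measurable_fun sq (fun z : Rk R (k + k) => Kl (halves z).1 (halves z).2 i j).
Proof.
have H := measurable_fun_comp_within (@continuous_halves R k) (@within_continuous_entry i j).
exact H.
Qed.

Lemma measurable_kernel_section xi i j : Om xi ->
  measurable_fun (Om : set (Rk R k)) (fun s => Kl xi s i j).
Proof.
move=> Oxi.
have cp : continuous (fun s : 'rV[R]_k => (xi : 'rV[R]_k, s)).
  move=> s; apply: (@cvg_pair _ _ _ (nbhs s) (nbhs (xi : 'rV[R]_k)) (nbhs s)).
    exact: cvg_cst.
  exact: cvg_id.
have := measurable_fun_comp_within cp (@within_continuous_entry i j).
suff -> : (fun s : 'rV[R]_k => (xi : 'rV[R]_k, s)) @^-1` (Om `*` Om) = Om by [].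
by apply/seteqP; split => s /=; [case|split].
Qed.

(** Supplies the upper bound without which the [sup] in [Mmax] and in [modulus] need not dominate
    their sets. *)
Lemma kernel_bounded : exists C, forall xi s, Om xi -> Om s -> enorm (Kl xi s) <= C.
Proof.
have [|C HC] := @compact_within_bounded R _ (Om `*` Om)
   (fun t : 'rV[R]_k * 'rV[R]_k => enorm (Kl t.1 t.2)) _ (compact_setX cOm cOm).
  move=> t; apply: (@continuous_comp (subspace (Om `*` Om)) _ _
    (fun t : 'rV[R]_k * 'rV[R]_k => Kl t.1 t.2) (@enorm R m n)).
    exact: cKl.
  exact: continuous_enorm.
exists C => xi s O1 O2; apply: le_trans (ler_norm _) _.
exact: (HC (xi, s)).
Qed.

Lemma enorm_le_Mmax xi s : Om xi -> Om s -> enorm (Kl xi s) <= Mmax Om Kl.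
Proof.
move=> O1 O2; have [C HC] := kernel_bounded; apply: ub_le_sup.
  by exists C => _ [x Ox [t Ot <-]]; exact: HC.
by exists xi => //; exists s.
Qed.

Lemma enorm_le_modulus Delta xi s s' : Om xi -> Om s -> Om s' ->
  enorm (s - s' : 'rV[R]_k) <= Delta ->
  enorm (Kl xi s - Kl xi s') <= modulus Om Kl Delta.
Proof.
move=> O1 O2 O3 ss'; have [C HC] := kernel_bounded; apply: ub_le_sup.
  exists (C + C) => _ [[x [t t']] /= [Ox [Ot [Ot' _]]] <-].
  by apply: le_trans (enormB _ _) _; apply: lerD; exact: HC.
by exists (xi, (s', s)).
Qed.

Lemma Mmax_ge0 : 0 <= Mmax Om Kl.
Proof.
(* For empty [Om] the value is the default [sup set0 = 0]. *)
have [->|/set0P[x Ox]] := eqVneq Om set0; last first.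
  exact: le_trans (enorm_ge0 _) (enorm_le_Mmax Ox Ox).
rewrite /Mmax (_ : [set _ | _ in _ & _ in _] = set0) ?sup0//.
by apply/seteqP; split => // y [].
Qed.

Lemma modulus_ge0 Delta : 0 < Delta -> 0 <= modulus Om Kl Delta.
Proof.
move=> D0; have [->|/set0P[x Ox]] := eqVneq Om set0; last first.
  apply: le_trans (enorm_ge0 _) (@enorm_le_modulus Delta x x x Ox Ox Ox _).
  by rewrite subrr enorm0 ltW.
rewrite /modulus (_ : [set _ | _ in _] = set0) ?sup0//.
by apply/seteqP; split => // y [t []].
Qed.

End Rk_kernel.

Section step_image.
Context (R : realType) (k m n N : nat) (Om : set (Rk R k)) (P : 'I_N -> set (Rk R k)).
Hypothesis mP : forall i, measurable (P i).
Hypothesis disjP : forall i j, i != j -> P i `&` P j = set0.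
Hypothesis covP : \bigcup_(i in [set: 'I_N]) P i = Om.

Lemma HS_eq (K : Rk R k -> Rk R k -> 'M[R]_(m, n)) (x y : Rk R k -> 'cV[R]_n) :
  (forall s, Om s -> x s = y s) -> HS Om K x = HS Om K y.
Proof.
move=> xy; apply/funext => xi; apply/matrixP => i j; rewrite !mxE.
by apply: eq_Rintegral => s /set_mem /xy ->.
Qed.

(** Step functions are arbitrary outside [Om] and may form an infinite set, but [HS] sees only their
    values on [Om], hence only the index [t]. *)
Lemma finite_step_image (I : finType) (v : I -> 'I_N -> 'cV[R]_n)
    (K : Rk R k -> Rk R k -> 'M[R]_(m, n)) (X : set (Rk R k -> 'cV[R]_n)) :
  (forall x, X x -> exists t, forall i s, P i s -> x s = v t i) ->
  finite_set [set HS Om K x | x in X].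
Proof.
move=> Xv; have /choice[y yv] t := step_exists disjP (v t).
apply: (@sub_finite_set _ _ [set HS Om K (y t) | t in [set: I]]); last first.
  by apply: finite_image; exact: finite_finset.
move=> _ [x /Xv[t xv] <-]; exists t => //; apply: HS_eq => s.
by rewrite -covP => -[i _ Ps]; rewrite (xv _ _ Ps) (yv _ _ _ Ps).
Qed.

Lemma Lpnorm_le l (p r : R) (x : Rk R k -> 'cV[R]_l) : 0 < p -> 0 <= r ->
  (\int[leb R k]_(s in Om) (enorm (x s) `^ p)%:E <= (r `^ p)%:E)%E <->
  (Lpnorm p Om x <= r%:E)%E.
Proof.
move=> p0 r0; pose J := (\int[leb R k]_(s in Om) (enorm (x s) `^ p)%:E)%E.
change ((J <= (r `^ p)%:E)%E <-> (J `^ p^-1 <= r%:E)%E).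
have J0 : (0 <= J)%E by apply: integral_ge0 => s _; rewrite lee_fin powR_ge0.
have rE : r%:E = ((r `^ p)%:E `^ p^-1)%E.
  by rewrite poweR_EFin -powRrM mulfV ?gt_eqF// powRr1.
have JE : J = ((J `^ p^-1) `^ p)%E.
  by rewrite -poweRrM mulVf ?gt_eqF// poweRe1.
split=> H.
  rewrite rE; apply: gt0_ler_poweR => //; first by rewrite invr_ge0 ltW.
    by rewrite in_itv /= leey andbT.
  by rewrite in_itv /= leey andbT lee_fin powR_ge0.
rewrite JE -poweR_EFin; apply: gt0_ler_poweR => //; first exact: ltW.
  by rewrite in_itv /= leey andbT poweR_ge0.
by rewrite in_itv /= leey andbT lee_fin.
Qed.

End step_image.

(** * Assembly of the Hausdorff estimate *)

Theorem theorem1 (R : realType) (k m n : nat)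
  (Om : set (Rk R k)) (p q r : R)
  (K : Rk R k -> Rk R k -> 'M[R]_(m, n))
  (lam : R) (Kl : Rk R k -> Rk R k -> 'M[R]_(m, n))
  (gam Delta sigma : R)
  (N : nat) (Omi : 'I_N -> set (Rk R k))
  (a : nat) (c : nat) (e : 'I_c -> 'cV[R]_n) :
  (0 < k)%N -> (0 < m)%N -> (0 < n)%N ->
  compact (Om : set 'rV[R]_k) ->
  1 < p -> p^-1 + q^-1 = 1 -> 0 < r ->
  (* the kernel K *)
  lmeasurable_kernel Om K ->
  (\int[lebesgue R k]_(s in Om) \int[lebesgue R k]_(xi in Om)
      (powR (enorm (K xi s)) q)%:E < +oo)%E ->
  (* lambda and the continuous approximation K_lambda *)
  0 < lam ->
  {within [set t : 'rV[R]_k * 'rV[R]_k | Om t.1 /\ Om t.2],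
     continuous (fun t : 'rV[R]_k * 'rV[R]_k => Kl t.1 t.2)} ->
  ((\int[lebesgue R k]_(s in Om) \int[lebesgue R k]_(xi in Om)
      (powR (enorm (K xi s - Kl xi s)) q)%:E) `^ q^-1
     <= (lam / (2 * r))%:E)%E ->
  0 < gam -> 0 < Delta -> 0 < sigma ->
  (* Lambda = {Om_1, ..., Om_N} is a finite Delta-partition of Om *)
  (forall i, measurable (Omi i)) ->
  (forall i j, i != j -> Omi i `&` Omi j = set0) ->
  \bigcup_(i in [set: 'I_N]) Omi i = Om ->
  (forall i, (diam (Omi i : set 'rV[R]_k) <= Delta%:E)%E) ->
  (* Lambda_* : uniform partition z_j = j * delta of [0, gam], delta = gam / a *)
  (0 < a)%N ->
  (* E_sigma = {e_1, ..., e_c} is a finite sigma-net on the unit sphere *)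
  (forall l, enorm (e l) = 1) ->
  (forall x : 'cV[R]_n, enorm x = 1 -> exists l, enorm (x - e l) <= sigma) ->
  let delta := gam / a%:R in
  let z := fun j : 'I_a.+1 => j%:R * delta in
  let B := [set x : Rk R k -> 'cV[R]_n |
              exists (jj : 'I_N -> 'I_a.+1) (ll : 'I_N -> 'I_c),
                (forall i xi, Omi i xi -> x xi = z (jj i) *: e (ll i)) /\
                (\sum_(i < N) lebesgue R k (Omi i) * (powR (z (jj i)) p)%:E
                   <= (powR r p)%:E)%E] in
  let Fp := [set HS Om K x | x in Bp p Om r] in
  let Fd := [set HS Om K x | x in B] in
  let M := Mmax Om Kl in
  let muOm := fine (lebesgue R k Om) in
  let cst := 2 * powR r p * powR muOm q^-1 in
  let psi := 2 * r * powR muOm (2 / q) * modulus Om Kl Delta in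
  let phi := M * powR muOm (1 + q^-1) * delta in
  let alpha := M * powR muOm (1 + q^-1) * gam * sigma in
  finite_set Fd /\
  (hausdorff_q q Om Fp Fd
     <= (lam + cst * M / powR gam (p - 1) + psi + phi + alpha)%:E)%E.
Proof.
move=> k0 m0 n0 cOm p1 pq r0 mK _ lam0 cKl KKl gam0 D0 sig0 mP disjP covP diamP a0 e1
  net delta z B Fp Fd M muOm cst psi phi alpha.
have p0 : 0 < p by rewrite (lt_trans _ p1).
have qi : q^-1 = 1 - p^-1 by rewrite -pq addrC addKr.
have q0 : 0 < q by rewrite -invr_gt0 qi subr_gt0 invf_lt1.
have mOm : measurable Om by rewrite -covP; exact: fin_bigcup_measurable.
have Ooo : (leb R k Om < +oo)%E.
  have [C HC] := compact_entry_bounded cOm.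
  exact: (bounded_leb_lty HC).
have z0 j : 0 <= z j by rewrite mulr_ge0// divr_ge0// ltW.
have M0 : 0 <= M := Mmax_ge0 cOm cKl.
have om0 : 0 <= modulus Om Kl Delta := modulus_ge0 cOm cKl D0.
split.
  apply: (@finite_step_image R k m n N Om Omi disjP covP
    ({ffun 'I_N -> 'I_a.+1} * {ffun 'I_N -> 'I_c})%type
    (fun t i => z (t.1 i) *: e (t.2 i))).
  move=> x [jj [ll [xv _]]].
  by exists ([ffun i => jj i], [ffun i => ll i]) => i s /xv ->; rewrite !ffunE.
have bound0 : 0 <= lam + cst * M / powR gam (p - 1) + psi + phi + alpha.
  rewrite /cst /psi /phi /alpha.
  by rewrite !addr_ge0 ?divr_ge0 ?mulr_ge0 ?powR_ge0// ?ltW// divr_gt0// ltr0n.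
rewrite /hausdorff_q ge_max; apply/andP; split; apply: ge_ereal_sup; last first.
  (* The supremum over the discrete family: [y] lies in [Bp], so its image is at distance 0 from
     itself. *)
  move=> _ [_ [y [jj [ll [yv yr]]] <-] <-].
  apply: (@le_trans _ _ (Ldist q Om (HS Om K y) (HS Om K y))).
    apply: ereal_inf_lbound; exists (HS Om K y) => //; exists y => //.
    have yp : (\int[leb R k]_(s in Om) (enorm (y s) `^ p)%:E <= (r `^ p)%:E)%E.
      rewrite (integral_powR_step (leb R k) mP disjP covP p yv).
      by under eq_bigr do rewrite enormZ e1 mulr1 ger0_norm//.
    move/(Lpnorm_le Om y p0 (ltW r0)) : yp => yp; split => //; split.
      exact: (vmeasurable_step mP covP yv).
    exact: le_lt_trans yp (ltry r).
  rewrite /Ldist -(Lpnorm_le Om _ q0 bound0).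
  rewrite (eq_integral (fun=> 0%E)); last first.
    by move=> s _ /=; rewrite subrr enorm0 powR0// gt_eqF.
  by rewrite integral0 lee_fin powR_ge0.
move=> _ [_ [x [[mx _] xr] <-] <-].
move/(Lpnorm_le Om x p0 (ltW r0)) : xr => xr.
(* The difference of the kernels is formed on [R^(2k)], before passing to the product
   sigma-algebra. *)
have mF i j : measurable_fun
    (halves @^-1` (Om `*` Om : set ('rV[R]_k * 'rV[R]_k)) : set (Rk R (k + k)))
    (fun z : Rk R (k + k) => (K (halves z).1 (halves z).2 -
      Kl (halves z).1 (halves z).2) i j).
  have := measurable_funB (mK i j) (measurable_kernel_square cKl i j).
  by apply: eq_measurable_fun => w _; rewrite !mxE.
have [F' [Q [mF' mQ Q0 FF']]] :=
  kernel_product_approx cOm (F := fun xi s => K xi s - Kl xi s) mF.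
have l0 : 0 <= lam / (2 * r) by rewrite divr_ge0 ?mulr_ge0// ltW.
have KKl' : (\int[leb R k]_(s in Om) \int[leb R k]_(xi in Om)
    (enorm (K xi s - Kl xi s) `^ q)%:E <= ((lam / (2 * r)) `^ q)%:E)%E.
  move: KKl; pose J := (\int[leb R k]_(s in Om) \int[leb R k]_(xi in Om)
    (enorm (K xi s - Kl xi s) `^ q)%:E)%E.
  change ((J `^ q^-1 <= (lam / (2 * r))%:E)%E -> (J <= ((lam / (2 * r)) `^ q)%:E)%E).
  have J0 : (0 <= J)%E.
    apply: integral_ge0 => s _; apply: integral_ge0 => xi _.
    by rewrite lee_fin powR_ge0.
  have JE : J = ((J `^ q^-1) `^ q)%E by rewrite -poweRrM mulVf ?gt_eqF// poweRe1.
  move=> H; rewrite JE -poweR_EFin; apply: gt0_ler_poweR => //; first exact: ltW.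
    by rewrite in_itv /= leey andbT poweR_ge0.
  by rewrite in_itv /= leey andbT lee_fin.
have PO i s : Omi i s -> Om s by move=> Ps; rewrite -covP; exists i.
have cmu : measure_is_complete (leb R k) by exact: measure_is_complete_caratheodory.
have mKl xi : Om xi -> forall i j, measurable_fun Om (fun s => Kl xi s i j).
  by move=> Oxi i j; exact: (measurable_kernel_section cKl).
have KlM xi s : Om xi -> Om s -> enorm (Kl xi s) <= M by exact: enorm_le_Mmax.
have Klom xi i s s' : Om xi -> Omi i s -> Omi i s' ->
    enorm (Kl xi s - Kl xi s') <= modulus Om Kl Delta.
  move=> Oxi Ps Ps'; apply: enorm_le_modulus => //; [exact: PO Ps|exact: PO Ps'|].
  rewrite -lee_fin; apply: le_trans (diamP i); apply: ereal_sup_ubound.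
  by exists s => //; exists s'.
have [jj [ll [zr Hy]]] := step_distance cmu mP disjP covP Ooo p1 pq r0 gam0 sig0 lam0
  M0 om0 n0 a0 e1 net mF' mQ Q0 FF' KKl' mKl KlM Klom mx xr.
have [y yv] := step_exists disjP (fun i => z (jj i) *: e (ll i)).
apply: (@le_trans _ _ (Ldist q Om (HS Om K x) (HS Om K y))).
  apply: ereal_inf_lbound; exists (HS Om K y) => //; exists y => //.
  by exists jj, ll.
apply: le_trans (Hy y yv) _; rewrite lee_fin.
rewrite /cst /psi /phi /alpha /delta -/muOm.
have mu0 : 0 <= muOm by exact: fine_ge0.
have qi0 : 0 < q^-1 by rewrite invr_gt0.
(* One factor comes from Hoelder in [s], the other from the [L_q] norm of a constant in [xi]. In
   [1 + q^-1] below, the 1 comes from integrating the rounding error over [s]. *)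
have -> : powR muOm (2 / q) = powR muOm q^-1 * powR muOm q^-1.
  by rewrite mulr_natl mulr2n powRD// gt_eqF// addr_gt0.
have -> : powR muOm (1 + q^-1) = muOm * powR muOm q^-1.
  by rewrite powRD ?powRr1// gt_eqF// addr_gt0.
(* The estimate yields half of the term [cst * M / powR gam (p - 1)]; [h] says that the other half
   is nonnegative. *)
have h : 0 <= r `^ p * muOm `^ q^-1 * M / gam `^ (p - 1).
  by rewrite divr_ge0 ?mulr_ge0 ?powR_ge0.
move: h; set A := gam `^ (p - 1); set W := muOm `^ q^-1; set Y := r `^ p.
by lra.
Qed.
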